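(* Multi-root hollow heaps, with operations as defined in the context, correctly implement all the heap operations (every operation returns the item or heap prescribed by its specification), maintain every heap as a collection of heap-ordered trees, and maintain at all times the following rank invariant: a node $u$ of rank $r$ has exactly $r$ children, of ranks $0,1,\ldots,r-1$, unless $r>2$ and $u$ was made hollow by a decrease-key, in which case $u$ has exactly two children, of ranks $r-2$ and $r-1$.
   Context: Heaps. A heap stores a finite set of items, each with a key from a totally ordered universe, and supports: make-heap() (return an empty heap); find-min($h$) (return an item of minimum key in $h$, or null if $h$ is empty); insert($e,k,h$) (add item $e$, which is in no heap, with key $k$); delete-min($h$) (delete from non-empty $h$ the item that find-min($h$) returns); meld($h_1,h_2$) (return a heap containing all items of the item-disjoint heaps $h_1,h_2$); decrease-key($e,k,h$) (given an item $e$ in $h$ with key greater than $k$, change its key to $k$); delete($e,h$) (delete item $e$ from $h$). Heaps passed as arguments are destroyed; decrease-key and delete are given the location of $e$. Nodes. Nodes hold items: each node holds at most one item, and is full if it holds one and hollow otherwise; each item in a heap is held by exactly one node; a newly created node is full and a hollow node never becomes full again. Each node $u$ has a key $u.key$ (the current key of its item if $u$ is full; if $u$ is hollow, the key its item had just before leaving $u$) and a non-negative integer rank $u.rank$. A tree (or dag) of nodes with arcs from parent to child is heap-ordered if $v.key\le w.key$ for every arc $(v,w)$. For two full roots, link makes the one of larger key (ties broken arbitrarily) a child of the other; the new child is the loser and the other the winner. A ranked link is a link of two roots of equal rank and increases the winner's rank by one. Multi-root hollow heap. It is either empty or a set of heap-ordered rooted trees of nodes, together with a pointer to a full root whose key is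 minimum among all nodes (the minimum node). make-heap returns the empty set of trees; find-min returns the item in the minimum node; meld returns one heap if the other is empty, and otherwise unites the two sets of trees and updates the minimum node; insert($e,k,h$) creates a new full node of rank 0 holding $e$ with key $k$ and melds this one-node heap with $h$. decrease-key($e,k,h$), with $u$ the node holding $e$: if $u$ is a root one may simply set $u.key=k$ and update the minimum node; otherwise create a new node $v$, move $e$ from $u$ to $v$ (so $u$ becomes hollow), set $v.key=k$ and $v.rank=\max\{0,u.rank-2\}$, move every child of $u$ of rank less than $v.rank$ (with its subtree) to become a child of $v$, and meld the tree rooted at $v$ with the heap. delete($e,h$) removes $e$ from the node $u$ holding it, making $u$ hollow; if $u$ is not the minimum node this completes the operation; otherwise, while some root is hollow, destroy such a root, making its children roots; then do ranked links while two roots have equal rank; finally make a root of minimum key the minimum node. delete-min($h$) performs delete on the item in the minimum node. *)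

(* Defs.v *)
From mathcomp Require Import all_boot all_order.
From mathcomp Require Export finmap.
From Stdlib Require Export Relation_Operators.

Set Implicit Arguments.
Unset Strict Implicit.
Unset Printing Implicit Defensive.

Import Order.TTheory.
Local Open Scope fset_scope.
Local Open Scope fmap_scope.

(* K is the universe of keys, I the type of items.  Node locations and heap
   handles are natural numbers. *)
Section MultiRootHollowHeaps.

Context {d : Order.disp_t} {K : orderType d} {I : Type}.

(* What a node holds.  The two hollow values record which operation made the
   node hollow; the algorithm never tests them apart, only the rank invariant
   does. *)
Inductive content :=
  | Full of I
  | HollowByDecreaseKey
  | HollowByDelete.

Record node := Node { content_of : content; key_of : K; rank_of : nat }.

(* In the empty heap, [roots] is empty and [min_node] is [None]. *)
Record heap := Heap { roots : {fset nat}; min_node : option nat }.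

(* The memory: the existing nodes, the arcs (parent, child), and the live
   heaps.  Nothing in this type forces the arcs to form a forest. *)
Record state := State {
  nodes : {fmap nat -> node};
  arcs : {fset nat * nat};
  heaps : {fmap nat -> heap} }.

Definition empty_heap : heap := Heap fset0 None.
Definition init_state : state := State [fmap] fset0 [fmap].

Definition arc (s : state) : rel nat := fun u v => (u, v) \in arcs s.

Definition children (s : state) (u : nat) : {fset nat} :=
  [fset p.2 | p in arcs s & p.1 == u].

(* The default 0 is used only for locations where there is no node. *)
Definition rank (s : state) (u : nat) : nat :=
  oapp rank_of 0 (nodes s).[? u].

Definition is_full (s : state) (u : nat) : bool :=
  if (nodes s).[? u] is Some (Node (Full _) _ _) then true else false.

Definition is_hollow (s : state) (u : nat) : bool :=
  (u \in domf (nodes s)) && ~~ is_full s u.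

(* False unless both nodes exist. *)
Definition key_le (s : state) (u v : nat) : bool :=
  match (nodes s).[? u], (nodes s).[? v] with
  | Some nu, Some nv => (key_of nu <= key_of nv)%O
  | _, _ => false
  end.

Definition in_tree (s : state) (r u : nat) : Prop :=
  exists p : seq nat, path (arc s) r p /\ last r p = u.

Definition is_root (s : state) (h r : nat) : Prop :=
  exists2 H : heap, (heaps s).[? h] = Some H & r \in roots H.

Definition in_heap (s : state) (h u : nat) : Prop :=
  exists2 r : nat, is_root s h r & in_tree s r u.

(* Node u of heap h holds item e, with key k. *)
Definition holds (s : state) (h u : nat) (e : I) (k : K) : Prop :=
  in_heap s h u /\
  exists j : nat, (nodes s).[? u] = Some (Node (Full e) k j).

(* The abstract value of a heap: its items with their keys. *)
Definition contents (s : state) (h : nat) (e : I) (k : K) : Prop :=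
  exists u : nat, holds s h u e k.

Inductive op :=
  | MakeHeap
  | FindMin of nat
  | Insert of I & K & nat
  | DeleteMin of nat
  | Meld of nat & nat
  | DecreaseKey of I & K & nat
  | Delete of I & nat.

(* [ResultItem None] is null. *)
Inductive result :=
  | ResultHeap of nat
  | ResultItem of option I.

(* An execution alternates [Ready] (between two operations), the [start] of an
   operation, and, only when the minimum node is deleted, a run of the two loops
   [Destroying] and [Linking] on the given heap, up to [Returned]. *)
Inductive config :=
  | Ready of state
  | Destroying of nat & state
  | Linking of nat & state
  | Returned of result & state.

Definition state_of (c : config) : state :=
  match c with
  | Ready s | Destroying _ s | Linking _ s | Returned _ s => s
  end.

Definition set_node (s : state) (u : nat) (n : node) : state :=
  State (nodes s).[u <- n] (arcs s) (heaps s).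

(* An operation that returns a heap destroys its argument heaps hs and returns
   a heap under some handle that is then unused (possibly one of hs). *)
Definition unused (s : state) (hs : {fset nat}) (h' : nat) : Prop :=
  h' \notin domf (heaps s).[\ hs].

Definition return_heap (s : state) (hs : {fset nat}) (h' : nat) (H : heap) :
    config :=
  Returned (ResultHeap h')
    (State (nodes s) (arcs s) (heaps s).[\ hs].[h' <- H]).

(* m is one of a and b, with minimum key. *)
Definition smaller (s : state) (a b m : nat) : Prop :=
  (m = a /\ key_le s a b) \/ (m = b /\ key_le s b a).

Inductive melded (s : state) (H1 H2 : heap) : heap -> Prop :=
  | MeldedEmptyL : roots H1 = fset0 -> melded s H1 H2 H2
  | MeldedEmptyR : roots H2 = fset0 -> melded s H1 H2 H1
  | MeldedUnion m1 m2 m :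
      roots H1 <> fset0 -> roots H2 <> fset0 ->
      min_node H1 = Some m1 -> min_node H2 = Some m2 -> smaller s m1 m2 m ->
      melded s H1 H2 (Heap (roots H1 `|` roots H2) (Some m)).

Definition singleton_heap (v : nat) : heap := Heap [fset v] (Some v).

(* The children of u of rank less than the rank of v become children of v. *)
Definition move_children (s : state) (u v : nat) : state :=
  State (nodes s)
    [fset (if (p.1 == u) && (rank s p.2 < rank s v)%N then (v, p.2) else p)
      | p in arcs s]
    (heaps s).

Definition destroy (s : state) (h : nat) (H : heap) (u : nat) : state :=
  State (nodes s).[~ u]
    [fset p in arcs s | p.1 != u]
    (heaps s).[h <- Heap ((roots H `\ u) `|` children s u) (min_node H)].

(* Ranked link of the winner w, whose node is nw, and the loser l. *)
Definition ranked_link (s : state) (h : nat) (H : heap) (w : nat) (nw : node)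
    (l : nat) : state :=
  State (nodes s).[w <- Node (content_of nw) (key_of nw) (rank_of nw).+1]
    ((w, l) |` arcs s)
    (heaps s).[h <- Heap (roots H `\ l) (min_node H)].

Inductive start_delete (s : state) (h u : nat) : config -> Prop :=
  | StartDeleteOther H e k j h' :
      (heaps s).[? h] = Some H -> min_node H <> Some u ->
      (nodes s).[? u] = Some (Node (Full e) k j) ->
      unused s [fset h] h' ->
      start_delete s h u
        (return_heap (set_node s u (Node HollowByDelete k j)) [fset h] h' H)
  | StartDeleteMinimum H e k j :
      (heaps s).[? h] = Some H -> min_node H = Some u ->
      (nodes s).[? u] = Some (Node (Full e) k j) ->
      start_delete s h u
        (Destroying h (set_node s u (Node HollowByDelete k j))).

Inductive start (s : state) : op -> config -> Prop :=
  | StartMakeHeap h' :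
      unused s fset0 h' ->
      start s MakeHeap (return_heap s fset0 h' empty_heap)
  | StartFindMinEmpty h H :
      (heaps s).[? h] = Some H -> roots H = fset0 ->
      start s (FindMin h) (Returned (ResultItem None) s)
  | StartFindMin h H m e k j :
      (heaps s).[? h] = Some H -> roots H <> fset0 -> min_node H = Some m ->
      (nodes s).[? m] = Some (Node (Full e) k j) ->
      start s (FindMin h) (Returned (ResultItem (Some e)) s)
  | StartInsert e k h H u s1 H' h' :
      (heaps s).[? h] = Some H ->
      u \notin domf (nodes s) ->
      s1 = set_node s u (Node (Full e) k 0) ->
      melded s1 (singleton_heap u) H H' ->
      unused s [fset h] h' ->
      start s (Insert e k h) (return_heap s1 [fset h] h' H')
  | StartMeld h1 h2 H1 H2 H' h' :
      (heaps s).[? h1] = Some H1 -> (heaps s).[? h2] = Some H2 ->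
      melded s H1 H2 H' ->
      unused s [fset h1; h2] h' ->
      start s (Meld h1 h2) (return_heap s [fset h1; h2] h' H')
  (* The shortcut for a root; taking it is optional. *)
  | StartDecreaseKeyRoot e k h H u k0 j m s1 m' h' :
      (heaps s).[? h] = Some H -> u \in roots H ->
      (nodes s).[? u] = Some (Node (Full e) k0 j) ->
      s1 = set_node s u (Node (Full e) k j) ->
      min_node H = Some m -> smaller s1 m u m' ->
      unused s [fset h] h' ->
      start s (DecreaseKey e k h)
        (return_heap s1 [fset h] h' (Heap (roots H) (Some m')))
  (* Subtraction on nat is truncated: [j - 2] is max {0, j - 2}. *)
  | StartDecreaseKey e k h H u k0 j v s1 s2 H' h' :
      (heaps s).[? h] = Some H -> in_heap s h u ->
      (nodes s).[? u] = Some (Node (Full e) k0 j) ->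
      v \notin domf (nodes s) ->
      s1 = set_node (set_node s u (Node HollowByDecreaseKey k0 j))
             v (Node (Full e) k (j - 2)) ->
      s2 = move_children s1 u v ->
      melded s2 (singleton_heap v) H H' ->
      unused s [fset h] h' ->
      start s (DecreaseKey e k h) (return_heap s2 [fset h] h' H')
  | StartDelete e h u k c :
      holds s h u e k -> start_delete s h u c -> start s (Delete e h) c
  | StartDeleteMin h H m c :
      (heaps s).[? h] = Some H -> roots H <> fset0 -> min_node H = Some m ->
      start_delete s h m c -> start s (DeleteMin h) c.

(* During the loops the field [min_node] of the heap is out of date and
   unused. *)
Inductive tick : config -> config -> Prop :=
  | TickDestroy h s H u :
      (heaps s).[? h] = Some H -> u \in roots H -> is_hollow s u ->
      tick (Destroying h s) (Destroying h (destroy s h H u))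
  | TickDestroyed h s H :
      (heaps s).[? h] = Some H ->
      (forall u, u \in roots H -> ~~ is_hollow s u) ->
      tick (Destroying h s) (Linking h s)
  | TickLink h s H w nw l :
      (heaps s).[? h] = Some H -> w \in roots H -> l \in roots H -> w != l ->
      is_full s w -> is_full s l -> rank s w = rank s l -> key_le s w l ->
      (nodes s).[? w] = Some nw ->
      tick (Linking h s) (Linking h (ranked_link s h H w nw l))
  | TickFinishEmpty h s H h' :
      (heaps s).[? h] = Some H -> roots H = fset0 ->
      unused s [fset h] h' ->
      tick (Linking h s) (return_heap s [fset h] h' empty_heap)
  | TickFinish h s H m h' :
      (heaps s).[? h] = Some H ->
      {in roots H &, injective (rank s)} ->
      m \in roots H -> (forall u, u \in roots H -> key_le s m u) ->
      unused s [fset h] h' ->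
      tick (Linking h s)
        (return_heap s [fset h] h' (Heap (roots H) (Some m))).

Definition live (s : state) (h : nat) : Prop := h \in domf (heaps s).

Definition legal (s : state) (o : op) : Prop :=
  match o with
  | MakeHeap => True
  | FindMin h => live s h
  | Insert e _ h => live s h /\ forall h0 k0, ~ contents s h0 e k0
  | DeleteMin h => live s h /\ exists e k, contents s h e k
  | Meld h1 h2 =>
      live s h1 /\ live s h2 /\
      forall e k1 k2, ~ (contents s h1 e k1 /\ contents s h2 e k2)
  | DecreaseKey e k h =>
      live s h /\ exists k0, contents s h e k0 /\ (k < k0)%O
  | Delete e h => live s h /\ exists k, contents s h e k
  end.

(* The heaps hs are destroyed, a heap h' with contents C appears, and every
   other heap keeps its contents. *)
Definition replaces (s : state) (hs : {fset nat}) (s' : state) (h' : nat)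
    (C : I -> K -> Prop) : Prop :=
  [/\ h' \notin domf (heaps s) `\` hs,
      domf (heaps s') = h' |` (domf (heaps s) `\` hs),
      forall h, h \in domf (heaps s) `\` hs ->
        forall e k, contents s' h e k <-> contents s h e k
    & forall e k, contents s' h' e k <-> C e k].

(* The postconditions: operation o, started in state s, may return r in
   state s'. *)
Definition prescribed (s : state) (o : op) (r : result) (s' : state) : Prop :=
  match o, r with
  | MakeHeap, ResultHeap h' =>
      replaces s fset0 s' h' (fun _ _ => False)
  | FindMin h, ResultItem x =>
      [/\ domf (heaps s') = domf (heaps s),
          forall h0 e k, contents s' h0 e k <-> contents s h0 e k
        & match x with
          | None => forall e k, ~ contents s h e k
          | Some e => exists k, contents s h e k /\
              forall e0 k0, contents s h e0 k0 -> (k <= k0)%O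
          end]
  | Insert e k h, ResultHeap h' =>
      replaces s [fset h] s' h'
        (fun e0 k0 => (e0 = e /\ k0 = k) \/ contents s h e0 k0)
  | DeleteMin h, ResultHeap h' =>
      exists e, start s (FindMin h) (Returned (ResultItem (Some e)) s) /\
        replaces s [fset h] s' h' (fun e0 k0 => e0 <> e /\ contents s h e0 k0)
  | Meld h1 h2, ResultHeap h' =>
      replaces s [fset h1; h2] s' h'
        (fun e k => contents s h1 e k \/ contents s h2 e k)
  | DecreaseKey e k h, ResultHeap h' =>
      replaces s [fset h] s' h'
        (fun e0 k0 => (e0 = e /\ k0 = k) \/ (e0 <> e /\ contents s h e0 k0))
  | Delete e h, ResultHeap h' =>
      replaces s [fset h] s' h' (fun e0 k0 => e0 <> e /\ contents s h e0 k0)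
  | _, _ => False
  end.

Definition steps : config -> config -> Prop := clos_refl_trans config tick.

(* Total correctness of o from s, for every resolution of the arbitrary
   choices: o can start, has no infinite execution, never gets stuck, and
   returns only what is prescribed. *)
Definition implements (s : state) (o : op) : Prop :=
  (exists c, start s o c) /\
  forall c, start s o c ->
    Acc (fun c2 c1 => tick c1 c2) c /\
    forall c', steps c c' ->
      (exists c'', tick c' c'') \/
      (exists r s', c' = Returned r s' /\ prescribed s o r s').

(* The configurations that arise in sequences of legal operations, those inside
   the loops of a deletion included. *)
Inductive reachable : config -> Prop :=
  | ReachInit : reachable (Ready init_state)
  | ReachStart s o c :
      reachable (Ready s) -> legal s o -> start s o c -> reachable c
  | ReachTick c c' : reachable c -> tick c c' -> reachable c'
  | ReachReturn r s : reachable (Returned r s) -> reachable (Ready s).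

Definition rooted_tree (s : state) (r : nat) : Prop :=
  (forall u, ~~ arc s u r) /\
  forall u, in_tree s r u ->
    u \in domf (nodes s) /\
    exists! p : seq nat, path (arc s) r p /\ last r p = u.

Definition heap_ordered (s : state) (r : nat) : Prop :=
  forall v w, in_tree s r v -> arc s v w -> key_le s v w.

Definition heap_ordered_trees (s : state) : Prop :=
  (forall h r, is_root s h r -> rooted_tree s r /\ heap_ordered s r) /\
  (forall h1 h2 r1 r2 u, is_root s h1 r1 -> is_root s h2 r2 ->
    in_tree s r1 u -> in_tree s r2 u -> h1 = h2 /\ r1 = r2).

Definition rank_invariant (s : state) : Prop :=
  forall u n, (nodes s).[? u] = Some n ->
    let r := rank_of n in
    let child_ranks := [seq rank s w | w <- children s u] in
    (2 < r /\ content_of n = HollowByDecreaseKey ->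
       perm_eq child_ranks [:: r - 2; r - 1]) /\
    (~ (2 < r /\ content_of n = HollowByDecreaseKey) ->
       perm_eq child_ranks (iota 0 r)).

(* Each heap is empty, or its minimum node is a full root of minimum key among
   all its nodes. *)
Definition minimum_nodes (s : state) : Prop :=
  forall h H, (heaps s).[? h] = Some H ->
    (roots H = fset0 /\ min_node H = None) \/
    exists m, [/\ min_node H = Some m, m \in roots H, is_full s m
                & forall u, in_heap s h u -> key_le s m u].

Definition items_held_once (s : state) : Prop :=
  forall h1 h2 u1 u2 e k1 k2,
    holds s h1 u1 e k1 -> holds s h2 u2 e k2 -> h1 = h2 /\ u1 = u2.

End MultiRootHollowHeaps.

Arguments content : clear implicits.
Arguments node {d} K I.
Arguments state {d} K I.
Arguments op {d} K I.
Arguments config {d} K I.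

(* Main.v *)
(* Every node has at most one parent and roots have none, so a path from a root
   is determined by its endpoint and the trees of distinct roots are disjoint;
   acyclicity is never needed.  The items of a heap are therefore governed by
   reachability from its root set, and each elementary change of the memory is
   checked to add or remove exactly the intended nodes.  A node is full until it
   is made hollow, hence has children of ranks 0, ..., j - 1 when decrease-key
   splits them at rank j - 2: the new node gets 0, ..., j - 3 and the hollow one
   keeps j - 2 and j - 1.  For the minimum it suffices, by heap order, to compare
   roots.  The loops of a deletion terminate because destroying a root decreases
   the number of nodes and a link decreases the number of roots; the latter loop
   cannot get stuck because all roots are then full and keys are totally
   ordered. *)
From mathcomp Require Import all_boot all_order.
From mathcomp Require Import zify.
Require Import Defs.

Set Implicit Arguments.
Unset Strict Implicit.
Unset Printing Implicit Defensive.

Import Order.TTheory.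
Local Open Scope fset_scope.
Local Open Scope fmap_scope.

(** Two strengths of invariant are needed. Between operations every heap has a full minimum node
    ([stable]); inside the loops of a deletion the minimum pointer of the heap at work is stale, so
    that heap is exempted ([stable_except]). The structural part [wf] constrains all existing nodes
    and all arcs, not only those under a root of a live heap; its clauses can then be checked
    locally at the arcs and nodes that a step changes. Postconditions compare the first and last
    states of an operation, while a deletion returns only after many ticks. The predicate
    [item_deleted] therefore relates every intermediate state to the initial one, and [on_track]
    carries it to the return. Items are followed through [holds], which names the node, rather than
    through [contents]: each operation must also reestablish that an item has a single holder, and
    from this comes the identification of the key mentioned by legality with the key stored in the
    node. *)

(** * Reachability from a set of roots, and its change under link, destruction and moving of
    children *)

Section Reachability.
Implicit Types (A : {fset nat * nat}) (R : {fset nat}).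

(** Derivations grow at the far end, so induction peels off the last arc, the one that uniqueness of
    parents controls. *)
Inductive below A R : nat -> Prop :=
  | BelowRoot r : r \in R -> below A R r
  | BelowArc u v : below A R u -> (u, v) \in A -> below A R v.

Lemma belowU A R1 R2 x :
  below A (R1 `|` R2) x <-> below A R1 x \/ below A R2 x.
Proof.
split.
  elim=> [r|u v _ [IH|IH] uv].
  - by rewrite inE => /orP[rR|rR]; [left|right]; apply: BelowRoot.
  - by left; apply: BelowArc uv.
  - by right; apply: BelowArc uv.
case; elim=> [r rR|u v _ IH uv]; try exact: BelowArc uv.
- by apply: BelowRoot; rewrite inE rR.
- by apply: BelowRoot; rewrite inE rR orbT.
Qed.

Lemma below_mono A A' R x :
  {subset A <= A'} -> below A R x -> below A' R x.
Proof.
move=> AA'; elim=> [r rR|u v _ IH /AA' uv]; first exact: BelowRoot.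
exact: BelowArc uv.
Qed.

Lemma below_parentless A R x :
  (forall u, (u, x) \notin A) -> below A R x -> x \in R.
Proof. by move=> xP xR; case: xR xP => // u v _ uv /(_ u); rewrite uv. Qed.

(** Two derivations for the same node end with the same arc, as parents are unique and roots have
    none; stripping such arcs leads back to a common root. *)
Lemma below_disjoint A R1 R2 x :
  (forall u u' v, (u, v) \in A -> (u', v) \in A -> u = u') ->
  (forall u r, r \in R1 `|` R2 -> (u, r) \notin A) ->
  [disjoint R1 & R2] ->
  below A R1 x -> ~ below A R2 x.
Proof.
move=> Afun rootP R12; elim=> [r r1|u v _ IH uv vR2].
  move/below_parentless => r2; move/fdisjointP: R12 => /(_ _ r1); rewrite r2 //.
  by move=> u; apply: rootP; rewrite inE r1.
case: vR2 uv => [r r2 ur|u' {}v u'2 u'v uv].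
  by have := rootP u r; rewrite inE r2 orbT ur => /(_ isT).
by rewrite (Afun _ _ _ uv u'v) in IH.
Qed.

(** The paths are compared backwards from their common end: unique parents match the last arcs, and
    parentless starting points force both paths to stop together. Uniqueness of paths within a tree
    and disjointness of trees both follow. *)
Lemma path_from_parentless_inj A r1 r2 p1 p2 :
  (forall u u' v, (u, v) \in A -> (u', v) \in A -> u = u') ->
  (forall u, (u, r1) \notin A) -> (forall u, (u, r2) \notin A) ->
  path (fun u v => (u, v) \in A) r1 p1 ->
  path (fun u v => (u, v) \in A) r2 p2 ->
  last r1 p1 = last r2 p2 -> r1 = r2 /\ p1 = p2.
Proof.
move=> Afun r1P r2P.
elim/last_ind: p1 p2 => [|p1 x IH] p2; case/lastP: p2 => [|p2 y] //=.
- by rewrite rcons_path last_rcons => _ /andP[_ yA] E; move: (r1P (last r2 p2));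
    rewrite E yA.
- by rewrite rcons_path last_rcons => /andP[_ xA] _ E; move: (r2P (last r1 p1));
    rewrite -E xA.
rewrite !rcons_path !last_rcons => /andP[p1P xA] /andP[p2P yA] E.
rewrite -{}E in yA *.
by have [-> ->] := IH p2 p1P p2P (Afun _ _ _ xA yA).
Qed.

(** The removed root [l] is still reached through the new arc, because [w] differs from [l] and so
    remains a root. *)
Lemma below_link A R w l x : w \in R -> l \in R -> w != l ->
  below ((w, l) |` A) (R `\ l) x <-> below A R x.
Proof.
move=> wR lR wl; split.
  elim=> [r|u v _ IH].
    by rewrite !inE => /andP[_ rR]; apply: BelowRoot.
  by rewrite !inE => /predU1P[[_ ->]|uv]; [apply: BelowRoot | apply: BelowArc uv].
elim=> [r rR|u v _ IH uv]; last by apply: BelowArc IH _; rewrite !inE uv orbT.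
have [->|rl] := eqVneq r l; last by apply: BelowRoot; rewrite !inE rl.
by apply: (@BelowArc _ _ w); [apply: BelowRoot; rewrite !inE wl | rewrite !inE eqxx].
Qed.

Lemma below_link_other A R w l x :
  ~ below A R w -> below ((w, l) |` A) R x <-> below A R x.
Proof.
move=> wN; split; last by apply: below_mono => p; rewrite !inE orbC => ->.
elim=> [r rR|u v _ IH]; first exact: BelowRoot.
by rewrite !inE => /predU1P[[uw]|uv]; [rewrite uw in IH | apply: BelowArc uv].
Qed.

(** A parentless [u] is reachable only as a root, so it is lost with its root status; whatever was
    reached through [u] lies under one of its children, which are now roots. *)
Lemma below_destroy A R C u x : u \in R -> (forall v, (v, u) \notin A) ->
  (forall v, (v \in C) = ((u, v) \in A)) ->
  below [fset p in A | p.1 != u] ((R `\ u) `|` C) x <-> x <> u /\ below A R x.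
Proof.
move=> uR uP CE; split.
  elim=> [r|v w _ [vu IH]].
    rewrite !inE CE => /orP[/andP[/eqP ru rR]|ur]; first by split=> //; apply: BelowRoot.
    split; first by move=> ru; move: (uP u); rewrite -{2}ru ur.
    by apply: BelowArc ur; apply: BelowRoot.
  rewrite !inE => /andP[vw _]; split; last exact: BelowArc vw.
  by move=> wu; move: (uP v); rewrite -wu vw.
case=> /[swap]; elim=> [r rR /eqP ru|v w _ IH vw wu].
  by apply: BelowRoot; rewrite !inE ru rR.
have [vu|vu] := eqVneq v u.
  by apply: BelowRoot; rewrite !inE CE -vu vw orbT.
by apply: BelowArc (IH (elimN eqP vu)) _; rewrite !inE vw.
Qed.

Lemma below_destroy_other A R u x : ~ below A R u ->
  below [fset p in A | p.1 != u] R x <-> below A R x.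
Proof.
move=> uN; split; first by apply: below_mono => p; rewrite !inE => /andP[].
elim=> [r rR|v w vR IH vw]; first exact: BelowRoot.
apply: BelowArc IH _; rewrite !inE vw /=.
by apply/eqP => vu; rewrite vu in vR.
Qed.

Lemma mem_moved A u v (P : pred nat) a b :
  ((a, b) \in [fset (if (p.1 == u) && P p.2 then (v, p.2) else p) | p in A]) =
  [&& a == v, (u, b) \in A & P b] || ((a, b) \in A) && ~~ ((a == u) && P b).
Proof.
apply/imfsetP/orP => /= [[[a' b'] abA]|].
  case: ifP => /= [/andP[/eqP a'u Pb] [-> ->]|NP [-> ->]].
    by left; rewrite eqxx -a'u abA.
  by right; rewrite abA NP.
case=> [/and3P[/eqP-> ubA Pb]|/andP[abA NP]].
  by exists (u, b) => //=; rewrite eqxx Pb.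
by exists (a, b) => //=; rewrite (negbTE NP).
Qed.

(** Before the move [v] has no children, so all that hangs below it afterwards came from [u], and
    was reachable because [u] was. Conversely a moved child is reached from the new root [v]. *)
Lemma below_move A R u v (P : pred nat) x :
  (forall w, (v, w) \notin A) -> below A R u ->
  below [fset (if (p.1 == u) && P p.2 then (v, p.2) else p) | p in A] (v |` R) x
  <-> x = v \/ below A R x.
Proof.
move=> vP uR; split.
  elim=> [r|a b _ IH]; first by rewrite !inE => /predU1P[->|rR]; [left|right; apply: BelowRoot].
  rewrite mem_moved => /orP[/and3P[_ ub _]|/andP[ab _]]; right; first exact: BelowArc ub.
  by case: IH => [av|IH]; [move: (vP b); rewrite -av ab | apply: BelowArc ab].
case=> [->|]; first by apply: BelowRoot; rewrite !inE eqxx.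
elim=> [r rR|a b _ IH ab]; first by apply: BelowRoot; rewrite !inE rR orbT.
case: (boolP ((a == u) && P b)) => [/andP[/eqP au Pb]|NP]; last first.
  by apply: BelowArc IH _; rewrite mem_moved ab NP orbT.
apply: (@BelowArc _ _ v); first by apply: BelowRoot; rewrite !inE eqxx.
by rewrite mem_moved eqxx -au ab Pb.
Qed.

Lemma below_move_other A R u v (P : pred nat) x :
  ~ below A R u -> ~ below A R v ->
  below [fset (if (p.1 == u) && P p.2 then (v, p.2) else p) | p in A] R x
  <-> below A R x.
Proof.
move=> uN vN; split; elim=> [r rR|a b aR IH ab]; try exact: BelowRoot.
  move: ab; rewrite mem_moved => /orP[/and3P[/eqP av _ _]|/andP[ab _]].
    by rewrite av in IH.
  exact: BelowArc ab.
apply: BelowArc IH _; rewrite mem_moved ab /=.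
by case: (a =P u) => [au|_]; [rewrite au in aR | rewrite /= orbT].
Qed.

End Reachability.

(** * State invariants, and how they and the held items pass to a returned heap *)

Section Invariants.
Context {d : Order.disp_t} {K : orderType d} {I : Type}.
Implicit Types (s : state K I) (H : heap) (u v w r h : nat) (e : I) (k : K).

Lemma in_heapE s h H x : (heaps s).[? h] = Some H ->
  in_heap s h x <-> below (arcs s) (roots H) x.
Proof.
move=> hH; split=> [[r [H' hH' rH] [p [+ <-]]]|].
  move: hH' rH; rewrite hH => -[<-] rH.
  elim/last_ind: p => [|p y IH]; first by move=> _; apply: BelowRoot.
  by rewrite rcons_path last_rcons => /andP[/IH pP]; apply: BelowArc.
elim=> [r rH|u v _ [r rR [p [pP uE]]] uv].
  by exists r; [exists H | exists [::]].
by exists r => //; exists (rcons p v); rewrite rcons_path last_rcons pP uE.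
Qed.

Lemma in_heap_live s h x : in_heap s h x -> exists H, (heaps s).[? h] = Some H.
Proof. by case=> r [H]; exists H. Qed.

Lemma in_heap_below s h x : in_heap s h x ->
  exists2 H, (heaps s).[? h] = Some H & below (arcs s) (roots H) x.
Proof.
by move=> hx; have [H hH] := in_heap_live hx; exists H => //; apply/(in_heapE _ hH).
Qed.

Lemma mem_children s u v : (v \in children s u) = arc s u v.
Proof.
apply/imfsetP/idP => [[[a b] /andP[ab /= /eqP <-] ->]|uv] //.
by exists (u, v) => //=; rewrite inE /= eqxx andbT.
Qed.

Lemma is_fullP s u :
  reflect (exists e k j, (nodes s).[? u] = Some (Node (Full e) k j))
          (is_full s u).
Proof.
rewrite /is_full; case: (nodes s).[? u] => [[[e||] k j]|]; constructor;
  by [exists e, k, j | case=> ? [? []]].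
Qed.

Lemma node_fnd s u n : (nodes s).[? u] = Some n -> u \in domf (nodes s).
Proof. by move=> un; rewrite -fndSome un. Qed.

(** All that [key_le] sees of a node: its existence and its key. Changes of content or rank leave it
    alone. *)
Definition node_key s u : option K := omap key_of (nodes s).[? u].

Lemma key_le_eq s s' u v : node_key s' u = node_key s u ->
  node_key s' v = node_key s v -> key_le s' u v = key_le s u v.
Proof.
rewrite /node_key /key_le; case: (nodes s').[? u] => [n1|]; case: (nodes s).[? u] => [n2|] //=.
by case=> ->; case: (nodes s').[? v] => [n3|]; case: (nodes s).[? v] => [n4|] //= [->].
Qed.

Lemma key_le_node s u v : key_le s u v ->
  (u \in domf (nodes s)) /\ (v \in domf (nodes s)).
Proof. by rewrite -!fndSome /key_le; do 2!case: (nodes s).[? _]. Qed.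

Lemma key_le_trans s u v w : key_le s u v -> key_le s v w -> key_le s u w.
Proof.
rewrite /key_le; case: (nodes s).[? u] => // a; case: (nodes s).[? v] => // b.
by case: (nodes s).[? w] => // c; apply: le_trans.
Qed.

Lemma key_le_total s u v : u \in domf (nodes s) -> v \in domf (nodes s) ->
  key_le s u v \/ key_le s v u.
Proof.
rewrite -!fndSome /key_le; case: (nodes s).[? u] => // a; case: (nodes s).[? v] => // b _ _.
exact/orP/le_total.
Qed.

(** Merges the two implications of [rank_invariant] into one list per node, so that the invariant
    becomes a single [perm_eq]. *)
Definition expected_ranks (n : node K I) : seq nat :=
  match n with
  | Node HollowByDecreaseKey _ r =>
      if 2 < r then [:: r - 2; r - 1] else iota 0 r
  | Node _ _ r => iota 0 r
  end.

Lemma rank_invariantP s : rank_invariant s <->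
  forall u n, (nodes s).[? u] = Some n ->
    perm_eq [seq rank s w | w <- children s u] (expected_ranks n).
Proof.
split=> inv u n un; have := inv u n un.
  case: n {un} => -[e||] k r [] /= I1 I2; try by apply: I2 => -[].
  by case: ifP => r2; [apply: I1 | apply: I2; rewrite r2 => -[]].
case: n {un} => -[e||] k r /= I1; split; try by case.
- by [].
- by move=> [r2 _]; rewrite r2 in I1.
- by case: ifP I1 => // _ _ [].
- by [].
Qed.

Lemma perm_children s s' u :
  children s' u =i children s u -> {in children s u, rank s' =1 rank s} ->
  perm_eq [seq rank s' w | w <- children s' u]
          [seq rank s w | w <- children s u].
Proof.
move=> /fsetP -> rankE; suff -> : [seq rank s' w | w <- children s u] =
  [seq rank s w | w <- children s u] by [].
exact/eq_in_map.
Qed.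

(** Since [key_le] is false on missing nodes, the first clause also says that arcs join existing
    nodes; hence no arc touches a fresh location. *)
Definition forest s :=
  [/\ forall u v, arc s u v -> key_le s u v,
      forall u u' v, arc s u v -> arc s u' v -> u = u'
    & rank_invariant s].

Definition rooted s :=
  (forall h r, is_root s h r ->
     r \in domf (nodes s) /\ forall u, ~~ arc s u r) /\
  (forall h h' r, is_root s h r -> is_root s h' r -> h = h').

(** Equality of the heaps is left to [in_heap_inj], so that only nodes have to be compared after
    each operation. *)
Definition item_determines_node s :=
  forall h h' u u' e k k',
    holds s h u e k -> holds s h' u' e k' -> u = u'.

Definition wf s := [/\ forest s, rooted s & item_determines_node s].

Lemma in_heap_node s h x : forest s -> rooted s -> in_heap s h x ->
  x \in domf (nodes s).
Proof.
move=> [ord _ _] [rP _] /in_heap_below[H hH]; case=> [r rH|u v _ /ord /key_le_node[]] //.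
by case: (rP h r) => //; exists H.
Qed.

(** Distinct heaps have disjoint sets of parentless roots, so [below_disjoint] separates everything
    under them. *)
Lemma in_heap_inj s h h' x : forest s -> rooted s ->
  in_heap s h x -> in_heap s h' x -> h = h'.
Proof.
move=> [_ par _] [rP rD] /in_heap_below[H hH xH] /in_heap_below[H' hH' xH'].
apply/eqP/negP => /negP hh'; case: (below_disjoint par _ _ xH xH').
  move=> u r; rewrite inE => /orP[rH|rH].
    by case: (rP h r) => [|_]; [exists H | apply].
  by case: (rP h' r) => [|_]; [exists H' | apply].
apply/fdisjointP => r rH; apply/negP => rH'.
by move/eqP: hh'; apply; apply: (rD _ _ r); [exists H | exists H'].
Qed.

Lemma root_in_heap s h r : is_root s h r -> in_heap s h r.
Proof. by exists r => //; exists [::]. Qed.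

Lemma forest_heap_ordered_trees s : forest s -> rooted s -> heap_ordered_trees s.
Proof.
move=> fs rs; have [ord par _] := fs; have [rP rD] := rs; split.
  move=> h r hr; have [_ rN] := rP h r hr; split; last by move=> v w _ /ord.
  split=> // u ru; split; first by apply: (in_heap_node (h := h)) => //; exists r.
  have [p [pP pE]] := ru; exists p; split=> // p' [p'P p'E].
  by have [] := path_from_parentless_inj par rN rN pP p'P (etrans pE (esym p'E)).
move=> h1 h2 r1 r2 u hr1 hr2 [p1 [p1P p1E]] [p2 [p2P p2E]].
have [_ r1N] := rP _ _ hr1; have [_ r2N] := rP _ _ hr2.
have [E _] := path_from_parentless_inj par r1N r2N p1P p2P (etrans p1E (esym p2E)).
by split=> //; apply: rD hr1 _; rewrite E.
Qed.

Lemma wf_items_held_once s : wf s -> items_held_once s.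
Proof.
move=> [fs rs once] h1 h2 u1 u2 e k1 k2 hu1 hu2.
have E := once _ _ _ _ _ _ _ hu1 hu2; split=> //.
by apply: in_heap_inj fs rs hu1.1 _; rewrite E; apply: hu2.1.
Qed.

(** Fullness of [m] is kept apart: when decrease-key moves the item out of the minimum node, [m] is
    hollow at the time of the meld, but its key still bounds the old roots. *)
Definition has_min s H m :=
  [/\ min_node H = Some m, m \in roots H
    & forall r, r \in roots H -> key_le s m r].

Definition good_heap s H :=
  (roots H = fset0 /\ min_node H = None) \/
  exists2 m, has_min s H m & is_full s m.

Definition stable s :=
  wf s /\ forall h H, (heaps s).[? h] = Some H -> good_heap s H.

Lemma has_min_in_heap s h H m x : forest s -> (heaps s).[? h] = Some H ->
  has_min s H m -> in_heap s h x -> key_le s m x.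
Proof.
move=> [ord _ _] hH [_ _ mP] /(in_heapE _ hH); elim=> [r /mP|u v _ IH /ord uv] //.
exact: key_le_trans IH uv.
Qed.

Lemma stable_minimum_nodes s : stable s -> minimum_nodes s.
Proof.
move=> [[fs _ _] good] h H hH; have [E|[m mH mF]] := good h H hH; first by left.
right; exists m; have [m1 m2 _] := mH; split=> // x.
exact: has_min_in_heap hH mH.
Qed.

(** Convertible to the state inside [return_heap], so the lemmas below apply directly to the
    configurations of [start] and [tick]. *)
Definition returned s (hs : {fset nat}) h' H : state K I :=
  State (nodes s) (arcs s) (heaps s).[\ hs].[h' <- H].

Lemma fnd_returned s hs h' H h :
  (heaps (returned s hs h' H)).[? h] =
  if h == h' then Some H else if h \in hs then None else (heaps s).[? h].
Proof. by rewrite /= fnd_set fnd_rem. Qed.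

Lemma is_root_returned s hs h' H h r : is_root (returned s hs h' H) h r ->
  (h = h' /\ r \in roots H) \/ [/\ h <> h', h \notin hs & is_root s h r].
Proof.
case=> H0; rewrite fnd_returned; case: eqP => [->|hh'].
  by case=> <- rH; left.
by case: ifP => // /negbT hN hH0 rH0; right; split=> //; exists H0.
Qed.

(** So far, the new roots may belong only to the argument heaps [hs]; these disappear, so no root is
    shared with a surviving heap. *)
Lemma returned_rooted s hs h' H : rooted s ->
  (forall r, r \in roots H ->
     [/\ r \in domf (nodes s), forall u, ~~ arc s u r
       & forall h, is_root s h r -> h \in hs]) ->
  rooted (returned s hs h' H).
Proof.
move=> [rP rD] HP; split=> [h r|h1 h2 r].
  case/is_root_returned=> [[_ /HP[]]|[_ _ /rP]] //.
case/is_root_returned=> [[-> rH]|[h1h' h1N h1r]];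
  case/is_root_returned=> [[-> rH']|[h2h' h2N h2r]] //.
- by have [_ _ /(_ _ h2r)] := HP r rH; rewrite (negbTE h2N).
- by have [_ _ /(_ _ h1r)] := HP r rH'; rewrite (negbTE h1N).
- exact: rD h1r h2r.
Qed.

Lemma returned_stable s hs h' H : forest s -> rooted s ->
  (forall r, r \in roots H ->
     [/\ r \in domf (nodes s), forall u, ~~ arc s u r
       & forall h, is_root s h r -> h \in hs]) ->
  (forall h H0, h \notin hs -> (heaps s).[? h] = Some H0 -> good_heap s H0) ->
  good_heap s H -> item_determines_node (returned s hs h' H) ->
  stable (returned s hs h' H).
Proof.
move=> fs rs HP good goodH once; split; first by split=> //; apply: returned_rooted.
move=> h H0; rewrite fnd_returned; case: eqP => [_ [<-]|_] //.
by case: ifP => // /negbT hN; apply: good.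
Qed.

(* [replaces] with the nodes holding the items made visible. *)
Definition transforms s (hs : {fset nat}) s' h' (P : nat -> I -> K -> Prop) :=
  [/\ h' \notin domf (heaps s) `\` hs,
      domf (heaps s') = h' |` (domf (heaps s) `\` hs),
      forall h, h \in domf (heaps s) `\` hs ->
        forall x e k, holds s' h x e k <-> holds s h x e k
    & forall x e k, holds s' h' x e k <-> P x e k].

Lemma transforms_replaces s hs s' h' P C : transforms s hs s' h' P ->
  (forall e k, C e k <-> exists x, P x e k) -> replaces s hs s' h' C.
Proof.
move=> [h'N domE oth new] CP; split=> //.
  by move=> h hN e k; split=> -[x] /(oth h hN) hx; exists x.
by move=> e k; rewrite CP; split=> -[x] /new hx; exists x.
Qed.

Lemma holds_live s h x e k : holds s h x e k -> h \in domf (heaps s).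
Proof. by move=> [/in_heap_live[H hH] _]; rewrite -fndSome hH. Qed.

Lemma transforms_holds s hs s' h' P h x e k : transforms s hs s' h' P ->
  holds s' h x e k -> P x e k \/ h \notin hs /\ holds s h x e k.
Proof.
move=> [h'N domE oth new] hx; move: (holds_live hx).
rewrite domE !inE => /orP[/eqP E|hN]; first by left; apply/new; rewrite -E.
by right; have/andP[hN' _] := hN; split=> //; apply/oth; rewrite ?inE.
Qed.

(** For make-heap, meld and the return from a deletion, where no item enters a node. *)
Lemma transforms_once_sub s hs s' h' P :
  item_determines_node s -> transforms s hs s' h' P ->
  (forall x e k, P x e k -> exists h k0, holds s h x e k0) ->
  item_determines_node s'.
Proof.
move=> once tr sub.
have old h x e k : holds s' h x e k -> exists h0 k0, holds s h0 x e k0.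
  by case/(transforms_holds tr) => [/sub|[_ hx]] //; exists h, k.
move=> h1 h2 u1 u2 e k1 k2 /old[h3 [k3 hu1]] /old[h4 [k4 hu2]].
exact: once hu1 hu2.
Qed.

(** For insert and both forms of decrease-key: [u0] is the node in which [e0] ends up, and the last
    hypothesis excludes a second holder of [e0] in the surviving heaps. *)
Lemma transforms_once_add s hs s' h' P u0 e0 :
  item_determines_node s -> transforms s hs s' h' P ->
  (forall x e k, P x e k ->
     x = u0 /\ e = e0 \/ e <> e0 /\ exists h k0, holds s h x e k0) ->
  (forall h x k, h \notin hs -> ~ holds s h x e0 k) ->
  item_determines_node s'.
Proof.
move=> once tr add no_e0.
have old h x e k : holds s' h x e k ->
    x = u0 /\ e = e0 \/ e <> e0 /\ exists h0 k0, holds s h0 x e k0.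
  case/(transforms_holds tr) => [/add|[hN hx]] //.
  right; split; last by exists h, k.
  by move=> E; rewrite E in hx; apply: no_e0 hx.
move=> h1 h2 u1 u2 e k1 k2 /old[[-> ->]|[ne [h3 [k3 hu1]]]] /old[[-> e'E]|[ne' [h4 [k4 hu2]]]] //.
exact: once hu1 hu2.
Qed.

(** An operation first edits nodes and arcs, giving [s2] with the heaps of [s], and then returns
    [H]. What remains to examine is the surviving heaps and reachability from the roots of [H] in
    [s2]. *)
Lemma transforms_returned s s2 hs h' H P :
  heaps s2 = heaps s -> unused s2 hs h' ->
  (forall h x e k, h \in domf (heaps s) `\` hs ->
     holds s2 h x e k <-> holds s h x e k) ->
  (forall x e k, P x e k <-> below (arcs s2) (roots H) x /\
     exists j, (nodes s2).[? x] = Some (Node (Full e) k j)) ->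
  transforms s hs (returned s2 hs h' H) h' P.
Proof.
rewrite /unused domf_rem => hE h'N oth new; rewrite hE in h'N.
split=> //.
- by rewrite -[heaps _]/(heaps s2).[\ hs].[h' <- H] dom_setf domf_rem hE.
- move=> h hN x e k; rewrite -oth //.
  have hh' : h != h' by apply: contra h'N => /eqP <-.
  have hhs : h \in hs = false by move: hN; rewrite inE => /andP[/negbTE].
  have E : (heaps (returned s2 hs h' H)).[? h] = (heaps s2).[? h].
    by rewrite fnd_returned (negbTE hh') hhs.
  split=> -[] /in_heap_below[H0 hH0 xH0] xn; split=> //.
    by apply/(in_heapE _ (H := H0)) => //; rewrite -E.
  by apply/(in_heapE _ (H := H0)) => //; rewrite E.
- move=> x e k; rewrite new.
  have E : (heaps (returned s2 hs h' H)).[? h'] = Some H by rewrite fnd_returned eqxx.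
  by split=> -[]; [move/(in_heapE _ E) | move=> xH; split=> //; apply/(in_heapE _ E)].
Qed.

End Invariants.

(** * Melding, fresh nodes, and the operations make-heap, meld, find-min and insert *)

Section Melding.
Context {d : Order.disp_t} {K : orderType d} {I : Type}.
Implicit Types (s : state K I) (H : heap) (u v w r h : nat) (e : I) (k : K).

Lemma below_fset0 A x : ~ below A fset0 x.
Proof. by elim. Qed.

Lemma below_leaf A v x : (forall w, (v, w) \notin A) ->
  below A [fset v] x <-> x = v.
Proof.
move=> vN; split=> [|->]; last by apply: BelowRoot; rewrite inE.
by elim=> [r|a b _ -> /(negP (vN b))] //; rewrite inE => /eqP.
Qed.

Lemma holdsE s h H x e k : (heaps s).[? h] = Some H ->
  holds s h x e k <-> below (arcs s) (roots H) x /\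
    exists j, (nodes s).[? x] = Some (Node (Full e) k j).
Proof. by move=> hH; rewrite /holds; split=> -[/(in_heapE _ hH)]. Qed.

Lemma rank_set_node s u n w :
  rank (set_node s u n) w = if w == u then rank_of n else rank s w.
Proof. by rewrite /rank /= fnd_set; case: eqP. Qed.

Lemma node_key_set_node s u n w :
  node_key (set_node s u n) w = if w == u then Some (key_of n) else node_key s w.
Proof. by rewrite /node_key /= fnd_set; case: eqP. Qed.

Lemma domf_set_node s u n w :
  (w \in domf (nodes (set_node s u n))) = (w == u) || (w \in domf (nodes s)).
Proof. by rewrite -[nodes _]/(nodes s).[u <- n] mem_setf inE. Qed.

Lemma arc_nodes s u v : forest s -> arc s u v ->
  (u \in domf (nodes s)) /\ (v \in domf (nodes s)).
Proof. by move=> [ord _ _] /ord /key_le_node. Qed.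

Lemma good_heap_min s H : good_heap s H ->
  roots H = fset0 \/ exists m, has_min s H m.
Proof. by case=> [[]|[m]]; [left | right; exists m]. Qed.

Lemma eq_good_heap s s' H :
  (forall r, r \in roots H -> (nodes s').[? r] = (nodes s).[? r]) ->
  good_heap s H -> good_heap s' H.
Proof.
move=> nE [|[m [mE mH mP] mF]]; [by left | right; exists m].
  split=> // r rH; rewrite (@key_le_eq _ _ _ s) ?mP // /node_key nE //.
by rewrite /is_full nE.
Qed.

Lemma melded_roots s H1 H2 H' : melded s H1 H2 H' ->
  roots H' = roots H1 `|` roots H2.
Proof. by case=> // ->; rewrite ?fset0U ?fsetU0. Qed.

(** The comparison that selected [m] is part of the conclusion because decrease-key uses it to
    exclude the choice of a minimum node that it has just made hollow. *)
Lemma melded_has_min s H1 H2 H' m1 m2 : has_min s H1 m1 -> has_min s H2 m2 ->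
  melded s H1 H2 H' -> exists2 m, has_min s H' m & smaller s m1 m2 m.
Proof.
move=> [m1E m1H m1P] [m2E m2H m2P]; case=> [E|E|m3 m4 m _ _].
- by rewrite E in m1H.
- by rewrite E in m2H.
rewrite m1E m2E => -[<-] [<-] sm; exists m => //; split=> //=.
  by case: sm => -[-> _]; rewrite inE ?m1H ?m2H ?orbT.
move=> r; rewrite inE.
by case: sm => -[-> le12] /orP[/m1P|/m2P] //; apply: key_le_trans le12.
Qed.

Lemma melded_good s H1 H2 H' : good_heap s H1 -> good_heap s H2 ->
  melded s H1 H2 H' -> good_heap s H'.
Proof.
move=> g1 g2; case: (g1) => [[H1r H1m]|[m1 m1P m1F]].
  by case=> // m3 m4 m /(_ H1r).
case: (g2) => [[H2r H2m]|[m2 m2P m2F]].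
  by case=> // m3 m4 m _ /(_ H2r).
move=> /(melded_has_min m1P m2P)[m mP sm]; right; exists m => //.
by case: sm => -[-> _].
Qed.

Lemma melded_exists s H1 H2 :
  roots H1 = fset0 \/ (exists m, has_min s H1 m) ->
  roots H2 = fset0 \/ (exists m, has_min s H2 m) ->
  exists H', melded s H1 H2 H'.
Proof.
move=> [E1|[m1 [m1E m1H m1P]]]; first by exists H2; apply: MeldedEmptyL.
move=> [E2|[m2 [m2E m2H m2P]]]; first by exists H1; apply: MeldedEmptyR.
have [m1N _] := key_le_node (m1P _ m1H); have [m2N _] := key_le_node (m2P _ m2H).
have ne (H : heap) m : m \in roots H -> roots H <> fset0 by move=> mH E; rewrite E in mH.
case: (key_le_total m1N m2N) => le12;
  [exists (Heap (roots H1 `|` roots H2) (Some m1))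
  |exists (Heap (roots H1 `|` roots H2) (Some m2))];
  by apply: MeldedUnion m1E m2E _; [apply: ne m1H | apply: ne m2H | by [left|right]].
Qed.

Lemma good_singleton s v : is_full s v -> good_heap s (singleton_heap v).
Proof.
move=> vF; right; exists v => //; split=> //=; first by rewrite inE.
move=> r; rewrite inE => /eqP ->.
by case/is_fullP: vF => e [k [j vn]]; rewrite /key_le vn /=.
Qed.

Lemma fresh_nat (A : {fset nat}) : exists x, x \notin A.
Proof.
have [n nP] : exists n, forall x, x \in (A : seq nat) -> x < n.
  elim: (A : seq nat) => [|y l [n nP]]; first by exists 0.
  exists (maxn n y.+1) => x; rewrite inE => /predU1P[->|/nP]; lia.
by exists n; apply/negP => /nP; rewrite ltnn.
Qed.

Lemma unused_exists s hs : exists h', unused s hs h'.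
Proof. exact: fresh_nat. Qed.

(** No arc touches a location without a node, so [u] starts parentless and childless, as an empty
    list of expected ranks demands. *)
Lemma fresh_forest s u n : forest s -> u \notin domf (nodes s) ->
  expected_ranks n = [::] -> forest (set_node s u n).
Proof.
move=> fs uN nE; have [ord par /rank_invariantP ranks] := fs.
have arc_neq a b : arc s a b -> (a == u = false) /\ (b == u = false).
  by case/(arc_nodes fs) => aN bN; split; apply: contraNF uN => /eqP <-.
split=> //.
  move=> a b ab; have [au bu] := arc_neq _ _ ab.
  by rewrite (@key_le_eq _ _ _ s) ?ord // node_key_set_node ?au ?bu.
apply/rank_invariantP => w n'; rewrite /= fnd_set.
have rankE : {in children s w, rank (set_node s u n) =1 rank s}.
  by move=> c; rewrite mem_children => /arc_neq[_ cu]; rewrite rank_set_node cu.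
case: eqP => [-> [<-]|_ wn'].
  rewrite nE; suff -> : children (set_node s u n) u = fset0 by [].
  apply/fsetP => c; rewrite mem_children inE.
  by apply/negP => /(arc_neq u c)[]; rewrite eqxx.
by apply: perm_trans (ranks w n' wn'); apply: perm_children.
Qed.

Lemma set_node_rooted s u n : rooted s -> rooted (set_node s u n).
Proof.
move=> [rP rD]; split=> // h r /rP[rN ru]; split=> //.
by rewrite domf_set_node rN orbT.
Qed.

Lemma holds_set_other s u n h x e k : x <> u ->
  holds (set_node s u n) h x e k <-> holds s h x e k.
Proof. by move=> /eqP/negbTE xu; rewrite /holds /= fnd_set xu. Qed.

Lemma make_heap_spec s h' : stable s -> unused s fset0 h' ->
  let s' := returned s fset0 h' empty_heap in
  stable s' /\ prescribed s (@MakeHeap _ K I) (ResultHeap h') s'.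
Proof.
move=> [[fs rs once] good] h'N s'.
have tr : transforms s fset0 s' h' (fun _ _ _ => False).
  by apply: transforms_returned => // x e k; split=> // -[/below_fset0].
split; last by apply: transforms_replaces tr _ => e k; split=> // -[].
apply: returned_stable => //; [by move=> h H _; apply: good | by left |].
exact: transforms_once_sub once tr _.
Qed.

Lemma roots_of_heaps_returnable s (hs : {fset nat}) H :
  (forall r, r \in roots H -> exists2 h, h \in hs & is_root s h r) -> rooted s ->
  forall r, r \in roots H ->
     [/\ r \in domf (nodes s), forall u, ~~ arc s u r
       & forall h, is_root s h r -> h \in hs].
Proof.
move=> HP [rP rD] r /HP[h hhs hr]; have [rN ru] := rP h r hr.
by split=> // h0 /(rD _ _ _ hr) <-.
Qed.

Lemma meld_spec s h1 h2 H1 H2 H' h' : stable s ->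
  (heaps s).[? h1] = Some H1 -> (heaps s).[? h2] = Some H2 ->
  melded s H1 H2 H' -> unused s [fset h1; h2] h' ->
  let s' := returned s [fset h1; h2] h' H' in
  stable s' /\ prescribed s (@Meld _ K I h1 h2) (ResultHeap h') s'.
Proof.
move=> [[fs rs once] good] hH1 hH2 mel h'N s'; have HE := melded_roots mel.
have tr : transforms s [fset h1; h2] s' h'
    (fun x e k => holds s h1 x e k \/ holds s h2 x e k).
  apply: transforms_returned => // x e k.
  rewrite (holdsE _ _ _ hH1) (holdsE _ _ _ hH2) HE belowU; tauto.
split; last first.
  apply: transforms_replaces tr _ => e k; split.
    by case=> -[x hx]; exists x; [left|right].
  by case=> x [hx|hx]; [left|right]; exists x.
apply: returned_stable => //.
- apply: roots_of_heaps_returnable => // r; rewrite HE inE.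
  by case/orP=> rH; [exists h1|exists h2]; rewrite ?inE ?eqxx ?orbT //; [exists H1|exists H2].
- by move=> h H _; apply: good.
- by apply: melded_good mel; [apply: good hH1 | apply: good hH2].
apply: transforms_once_sub once tr _ => x e k.
by case=> hx; [exists h1, k | exists h2, k].
Qed.

Lemma find_min_spec s h c : stable s -> start s (FindMin h) c ->
  exists2 x, c = Returned (ResultItem x) s &
    prescribed s (@FindMin _ K I h) (ResultItem x) s.
Proof.
move=> [[fs rs once] good] st; inversion_clear st.
  exists None => //; split=> // e k [x /(holdsE _ _ _ H0)[]].
  by rewrite H1 => /below_fset0.
exists (Some e) => //; split=> //.
case: (good _ _ H0) => [[]|[m' m'P m'F]] //.
have [m'E m'H _] := m'P; rewrite H2 in m'E; case: m'E => E.
exists k; split.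
  by exists m; apply/(holdsE _ _ _ H0); split; [apply: BelowRoot; rewrite E | exists j].
move=> e0 k0 [x [xh [j0 xn]]]; have := has_min_in_heap fs H0 m'P xh.
by rewrite -E /key_le H3 xn.
Qed.

Lemma insert_spec s e k h H u H' h' : stable s ->
  (forall h0 k0, ~ contents s h0 e k0) ->
  (heaps s).[? h] = Some H -> u \notin domf (nodes s) ->
  let s1 := set_node s u (Node (Full e) k 0) in
  melded s1 (singleton_heap u) H H' -> unused s1 [fset h] h' ->
  let s' := returned s1 [fset h] h' H' in
  stable s' /\ prescribed s (Insert e k h) (ResultHeap h') s'.
Proof.
move=> [[fs rs once] good] new hH uN s1 mel h'N s'; have HE := melded_roots mel.
have fs1 : forest s1 by apply: fresh_forest.
have rs1 : rooted s1 by apply: set_node_rooted.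
have uleaf w : (u, w) \notin arcs s by apply: contra uN => /(arc_nodes fs)[].
have uroot w : (w, u) \notin arcs s by apply: contra uN => /(arc_nodes fs)[].
have s1n x : x \in domf (nodes s) -> (nodes s1).[? x] = (nodes s).[? x].
  by rewrite /= fnd_set; case: eqP => // -> /(negP uN).
have s1holds h0 x e0 k0 : in_heap s h0 x -> holds s1 h0 x e0 k0 <-> holds s h0 x e0 k0.
  by move=> /(in_heap_node fs rs) xN; apply: holds_set_other => E; rewrite -E xN in uN.
have s1good h0 H0 : (heaps s).[? h0] = Some H0 -> good_heap s1 H0.
  move=> hH0; apply: eq_good_heap (good _ _ hH0) => r rH.
  by apply: s1n; apply: (rs.1 h0 r _).1; exists H0.
have tr : transforms s [fset h] s' h'
    (fun x e0 k0 => (x = u /\ e0 = e /\ k0 = k) \/ holds s h x e0 k0).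
  apply: transforms_returned => // [h0 x e0 k0 _|x e0 k0].
    by split=> hx; apply/s1holds => //; apply: hx.1.
  rewrite HE belowU below_leaf //; split.
    case=> [[-> [-> ->]]|hx].
      by split; [left | exists 0; rewrite /= fnd_set eqxx].
    have /(holdsE _ _ _ hH)[xH _] := hx.
    by have [_ [j xn]] := (s1holds h x e0 k0 hx.1).2 hx; split; [right | exists j].
  case=> -[->|xH] [j xn].
    by left; move: xn; rewrite /= fnd_set eqxx => -[-> ->].
  have xh : in_heap s h x by apply/in_heapE; eauto.
  by right; apply/s1holds => //; split=> //; exists j.
split; last first.
  apply: transforms_replaces tr _ => e0 k0; split.
    by case=> [[-> ->]|[x hx]]; [exists u; left | exists x; right].
  by case=> x [[_ [-> ->]]|hx]; [left | right; exists x].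
apply: returned_stable => //.
- move=> r; rewrite HE in_fsetU => /orP[/fset1P->|rH].
    split=> //; first by rewrite domf_set_node eqxx.
    by move=> h0 [H0 hH0 uH]; case/negP: uN; apply: (rs.1 h0 u _).1; exists H0.
  have hr : is_root s1 h r by exists H.
  have [rN ru] := rs1.1 h r hr; split=> // h0 h0r.
  by rewrite inE (rs.2 _ _ _ h0r hr).
- by move=> h0 H0 _; apply: s1good.
- apply: melded_good mel; last exact: s1good hH.
  by apply: good_singleton; rewrite /is_full /= fnd_set eqxx.
apply: (transforms_once_add (u0 := u) (e0 := e)) once tr _ _ => [x e0 k0|h0 x k0 _ hx].
  case=> [[-> [-> _]]|hx]; [by left | right; split; last by exists h, k0].
  by move=> E; apply: (new h k0); exists x; rewrite -E.
by apply: (new h0 k0); exists x.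
Qed.

End Melding.

(** * Decrease-key, by the shortcut at a root and through a new node *)

Section KeyDecrease.
Context {d : Order.disp_t} {K : orderType d} {I : Type}.
Implicit Types (s : state K I) (H : heap) (u v w r h : nat) (e : I) (k : K).

(** Legality speaks of some holder of [e] and some key; uniqueness identifies them with the node
    that the operation works on and the key stored there. *)
Lemma holds_key s h u h' u' e k n : item_determines_node s ->
  (nodes s).[? u] = Some n -> holds s h u e (key_of n) ->
  holds s h' u' e k -> u' = u /\ k = key_of n.
Proof.
move=> once un hu hu'; have E := once _ _ _ _ _ _ _ hu' hu; split=> //.
by case: hu' => _ [j]; rewrite E un => -[->].
Qed.

(** Serves both the key change at a root and the hollowing of a node by a deletion: arcs, ranks and
    expected ranks persist, so only heap order is left to the caller. *)
Lemma replace_node_forest s u n n' : forest s -> (nodes s).[? u] = Some n ->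
  rank_of n' = rank_of n -> expected_ranks n' = expected_ranks n ->
  (forall a b, arc s a b -> key_le (set_node s u n') a b) ->
  forest (set_node s u n').
Proof.
move=> [_ par /rank_invariantP ranks] un rE eE ord; split=> //.
have rankE : rank (set_node s u n') =1 rank s.
  by move=> w; rewrite rank_set_node; case: eqP => // ->; rewrite /rank un.
apply/rank_invariantP => w n0 wn0.
apply: perm_trans (perm_children (s := s) _ _) _ => //.
move: wn0; rewrite /= fnd_set; case: eqP => [-> [<-]|_ /ranks] //.
by rewrite eE; apply: ranks.
Qed.

Lemma decrease_key_root_spec s e k h H u k0 j m m' h' :
  stable s -> legal s (DecreaseKey e k h) ->
  (heaps s).[? h] = Some H -> u \in roots H ->
  (nodes s).[? u] = Some (Node (Full e) k0 j) ->
  let s1 := set_node s u (Node (Full e) k j) in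
  min_node H = Some m -> smaller s1 m u m' -> unused s1 [fset h] h' ->
  let s' := returned s1 [fset h] h' (Heap (roots H) (Some m')) in
  stable s' /\ prescribed s (DecreaseKey e k h) (ResultHeap h') s'.
Proof.
move=> [[fs rs once] good] [_ [k1 [[u1 hu1] lt_k]]] hH uH un s1 mE sm h'N s'.
have hu : holds s h u e k0.
  by apply/(holdsE _ _ _ hH); split; [apply: BelowRoot | exists j].
have [_ /= E] := holds_key once un hu hu1; rewrite {k1 u1 hu1}E in lt_k.
have rootu : is_root s h u by exists H.
have [uN uroot] := rs.1 h u rootu.
have s1n x : x <> u -> (nodes s1).[? x] = (nodes s).[? x].
  by move=> /eqP/negbTE xu; rewrite /= fnd_set xu.
have s1u : (nodes s1).[? u] = Some (Node (Full e) k j) by rewrite /= fnd_set eqxx.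
(* Lowering the key of [u] endangers only comparisons with [u] on the right; no arc is of this kind,
   as the root [u] has no parent. *)
have lower a b : b <> u -> key_le s a b -> key_le s1 a b.
  move=> bu; rewrite /key_le (s1n b bu); have [->|/eqP au] := eqVneq a u; last by rewrite s1n.
  by rewrite s1u un; case: (nodes s).[? b] => // n; apply/le_trans/ltW.
have fs1 : forest s1.
  apply: replace_node_forest un _ _ _ => //.
  have [ord _ _] := fs => a b ab; apply: lower (ord _ _ ab).
  by move=> bu; move: (uroot a); rewrite -bu ab.
have rs1 : rooted s1 by apply: set_node_rooted.
have s1other h0 x e0 k1 : h0 \in domf (heaps s) `\` [fset h] ->
    holds s1 h0 x e0 k1 <-> holds s h0 x e0 k1.
  rewrite !inE => /andP[/eqP h0h _]; have [xu|/eqP xu] := eqVneq x u; last exact: holds_set_other.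
  by split=> -[xh _]; case: h0h; apply: in_heap_inj fs rs xh _;
    rewrite xu; apply: root_in_heap.
have tr : transforms s [fset h] s' h'
    (fun x e0 k1 => (x = u /\ e0 = e /\ k1 = k) \/ (e0 <> e /\ holds s h x e0 k1)).
  apply: transforms_returned => // x e0 k1; split.
    case=> [[-> [-> ->]]|[e0e hx]].
      by split; [apply: BelowRoot | exists j].
    have xu : x <> u by move=> E; case: hx => _ [j0]; rewrite E un => -[/esym].
    by apply/(holdsE (s := s1) _ _ _ hH); apply/holds_set_other.
  move=> [xH [j0 xn]]; have [xu|/eqP xu] := eqVneq x u.
    by left; move: xn; rewrite xu s1u => -[-> ->].
  rewrite s1n // in xn.
  have hx : holds s h x e0 k1 by apply/(holdsE _ _ _ hH); split=> //; exists j0.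
  right; split=> // E; rewrite E in hx.
  by have [] := holds_key once un hu hx.
split; last first.
  apply: transforms_replaces tr _ => e0 k1; split.
    by case=> [[-> ->]|[e0e [x hx]]]; [exists u; left | exists x; right].
  by case=> x [[_ [-> ->]]|[e0e hx]]; [left | right; split=> //; exists x].
apply: returned_stable => //.
- move=> r rH; apply: (@roots_of_heaps_returnable _ _ _ _ _ (Heap (roots H) None)) => // r0 r0H.
  by exists h; [rewrite inE | exists H].
- move=> h0 H0; rewrite inE => /eqP h0h hH0; apply: eq_good_heap (good h0 H0 hH0) => r rH0.
  by apply: s1n => ru; apply: h0h; apply: (rs.2 _ _ u) rootu; exists H0; rewrite -?ru.
- case: (good _ _ hH) => [[E]|[m0 [m0E m0H m0P] m0F]]; first by rewrite E in uH.
  rewrite mE in m0E; case: m0E => E; subst m0.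
  right; exists m'; last first.
    case: sm => -[-> _]; last by rewrite /is_full s1u.
    by have [->|/eqP mu] := eqVneq m u; rewrite /is_full ?s1u // s1n.
  split=> //=; first by case: sm => -[->].
  move=> r rH; have [->|/eqP ru] := eqVneq r u.
    by case: sm => -[-> le_m] //; rewrite /key_le s1u /=.
  have le_mr := lower _ _ ru (m0P r rH).
  by case: sm => -[-> le_m] //; apply: key_le_trans le_mr.
apply: (transforms_once_add (u0 := u) (e0 := e) once tr) => [x e0 k1|h0 x k1 h0h hx].
  by case=> [[-> [-> _]]|[e0e hx]]; [left | right; split=> //; exists h, k1].
have [xu _] := holds_key once un hu hx; rewrite xu in hx.
by case/negP: h0h; rewrite inE; apply/eqP; apply: in_heap_inj fs rs hx.1 hu.1.
Qed.

Lemma arc_move s u v a b :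
  arc (move_children s u v) a b =
  [&& a == v, arc s u b & rank s b < rank s v] ||
  arc s a b && ~~ ((a == u) && (rank s b < rank s v)).
Proof. exact: (mem_moved _ _ _ (fun b => rank s b < rank s v)). Qed.

(** Applied with complementary predicates: to the children that the new node takes over from [u],
    and, with [u] itself for [v], to those that stay. *)
Lemma perm_ranks_filter s s' u v (P : pred nat) :
  (forall b, arc s' v b = arc s u b && P (rank s b)) ->
  (forall b, arc s u b -> rank s' b = rank s b) ->
  perm_eq [seq rank s' w | w <- children s' v]
          [seq r <- [seq rank s w | w <- children s u] | P r].
Proof.
move=> arcE rankE; rewrite filter_map.
have -> : [seq rank s' w | w <- children s' v] = [seq rank s w | w <- children s' v].
  apply/eq_in_map => b; rewrite mem_children arcE => /andP[ub _]; exact: rankE.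
apply/perm_map/uniq_perm; rewrite ?filter_uniq ?fset_uniq // => b.
by rewrite mem_children arcE mem_filter mem_children andbC.
Qed.

Lemma filter_iota_lt j : [seq r <- iota 0 j | r < j - 2] = iota 0 (j - 2).
Proof.
apply: (irr_sorted_eq ltn_trans ltnn) => [||r]; rewrite ?sorted_filter ?iota_ltn_sorted //.
  exact: ltn_trans.
by rewrite mem_filter !mem_iota; lia.
Qed.

(** Strictly increasing lists with the same members are equal. For [j <= 2] the truncated bound
    [j - 2] is 0 and every child stays: this is the origin of the case distinction in the rank
    invariant. *)
Lemma filter_iota_ge j : [seq r <- iota 0 j | ~~ (r < j - 2)] =
  if 2 < j then [:: j - 2; j - 1] else iota 0 j.
Proof.
apply: (irr_sorted_eq ltn_trans ltnn) => [||r].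
- by apply: sorted_filter (iota_ltn_sorted _ _); apply: ltn_trans.
- by case: ifP => [j2|_]; [rewrite /= andbT; lia | apply: iota_ltn_sorted].
by rewrite mem_filter mem_iota; case: ifP; rewrite ?mem_iota ?inE; lia.
Qed.

Lemma decrease_key_spec s e k h H u k0 j v H' h' :
  stable s -> legal s (DecreaseKey e k h) ->
  (heaps s).[? h] = Some H -> in_heap s h u ->
  (nodes s).[? u] = Some (Node (Full e) k0 j) ->
  v \notin domf (nodes s) ->
  let s1 := set_node (set_node s u (Node HollowByDecreaseKey k0 j))
              v (Node (Full e) k (j - 2)) in
  let s2 := move_children s1 u v in
  melded s2 (singleton_heap v) H H' -> unused s2 [fset h] h' ->
  let s' := returned s2 [fset h] h' H' in
  stable s' /\ prescribed s (DecreaseKey e k h) (ResultHeap h') s'.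
Proof.
move=> [[fs rs once] good] [_ [k1 [[u1 hu1] lt_k]]] hH uh un vN s1 s2 mel h'N s'.
have HE := melded_roots mel; have [ord par /rank_invariantP ranks] := fs.
have hu : holds s h u e k0 by split=> //; exists j.
have [_ /= E] := holds_key once un hu hu1; rewrite {k1 u1 hu1}E in lt_k.
have neq_v x : x \in domf (nodes s) -> x <> v by move=> xN E; rewrite -E xN in vN.
have uv : u <> v by apply/neq_v/node_fnd/un.
have vu : v == u = false by apply/eqP => /esym.
have vleaf w : (v, w) \notin arcs s by apply: contra vN => /(arc_nodes fs)[].
have vroot w : (w, v) \notin arcs s by apply: contra vN => /(arc_nodes fs)[].
have s2v : (nodes s2).[? v] = Some (Node (Full e) k (j - 2)).
  by rewrite /= fnd_set eqxx.
have s2u : (nodes s2).[? u] = Some (Node HollowByDecreaseKey k0 j).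
  by rewrite /= !fnd_set eq_sym vu eqxx.
have s2n x : x <> u -> x <> v -> (nodes s2).[? x] = (nodes s).[? x].
  by move=> /eqP/negbTE xu /eqP/negbTE xv; rewrite /= !fnd_set xu xv.
have rank2 x : x <> v -> rank s2 x = rank s x.
  move=> xv; rewrite /rank; have [->|/eqP xu] := eqVneq x u; last by rewrite s2n.
  by rewrite s2u un.
have rank2v : rank s2 v = j - 2 by rewrite /rank s2v.
have key2 x : x <> v -> node_key s2 x = node_key s x.
  move=> xv; rewrite /node_key; have [->|/eqP xu] := eqVneq x u; last by rewrite s2n.
  by rewrite s2u un.
(* [move_children] reads the ranks in [s1], where old nodes have kept theirs. They differ from those
   of [s] only at [v], and no arc enters [v]. *)
have arc2 a b : arc s2 a b = [&& a == v, arc s u b & rank s b < j - 2] ||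
    arc s a b && ~~ ((a == u) && (rank s b < j - 2)).
  rewrite /s2 arc_move -[rank s1 v]/(rank s2 v) rank2v -![arc s1 _ _]/(arc s _ _).
  have [->|/eqP bv] := eqVneq b v.
    by rewrite /arc !(negbTE (vroot _)) !andbF.
  by rewrite -[rank s1 b]/(rank s2 b) rank2.
have key_le2 a b : a <> v -> b <> v -> key_le s2 a b = key_le s a b.
  by move=> av bv; apply: key_le_eq; apply: key2.
have fs2 : forest s2.
  split.
  - move=> a b; rewrite arc2 => /orP[/and3P[/eqP-> ub _]|/andP[ab _]]; last first.
      have [aN bN] := arc_nodes fs ab.
      by rewrite key_le2 ?ord //; apply: neq_v.
    (* A moved child has key at least [k0], the key of its old parent [u], and [k < k0]. *)
    have [_ bN] := arc_nodes fs ub; apply: (@key_le_trans _ _ _ _ _ u).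
      by rewrite /key_le s2v s2u /= ltW.
    by rewrite key_le2 ?ord //; apply: neq_v.
  (* If one of the two arcs into [b] was moved and the other kept, both started at [u] in [s], and
     the kept one should have been moved as well. *)
  - move=> a a' b; rewrite !arc2.
    move=> /orP[/and3P[/eqP-> ub Pb]|/andP[ab NP]] /orP[/and3P[/eqP-> ub' Pb']|/andP[ab' NP']] //.
    + by rewrite (par _ _ _ ub ab') eqxx Pb in NP'.
    + by rewrite (par _ _ _ ub' ab) eqxx Pb' in NP.
    + exact: par ab ab'.
  apply/rank_invariantP => w n.
  have arc_rank a b : arc s a b -> rank s2 b = rank s b.
    by move=> /(arc_nodes fs)[_ bN]; apply/rank2/neq_v.
  have [->|/eqP wv] := eqVneq w v.
    rewrite s2v => -[<-] /=; rewrite -filter_iota_lt.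
    apply: perm_trans (perm_filter _ (ranks _ _ un)).
    apply: perm_ranks_filter => b; last exact: arc_rank.
    by rewrite arc2 eqxx /arc (negbTE (vleaf b)) orbF.
  have [->|/eqP wu] := eqVneq w u.
    rewrite s2u => -[<-] /=; rewrite -filter_iota_ge.
    apply: perm_trans (perm_filter _ (ranks _ _ un)).
    apply: perm_ranks_filter => b; last exact: arc_rank.
    by rewrite arc2 eqxx eq_sym vu.
  rewrite s2n // => wn; apply: perm_trans (ranks _ _ wn).
  move/eqP/negbTE: wv => wv; move/eqP/negbTE: wu => wu.
  apply: perm_children => b; first by rewrite !mem_children arc2 wv wu andbT.
  by rewrite mem_children; apply: arc_rank.
have rs2 : rooted s2.
  have [rP1 rD1] : rooted s1 by do 2!apply: set_node_rooted.
  split=> // h0 r h0r; have [rN _] := rP1 h0 r h0r; split=> // a.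
  have rroot : forall b, ~~ arc s b r := (rP1 h0 r h0r).2.
  by rewrite arc2 !(negbTE (rroot _)) !andbF.
have below2 R x : below (arcs s) R u ->
    below (arcs s2) (v |` R) x <-> x = v \/ below (arcs s) R x.
  exact: (below_move (fun b => rank s1 b < rank s1 v)).
have below2_other R x : ~ below (arcs s) R u -> ~ below (arcs s) R v ->
    below (arcs s2) R x <-> below (arcs s) R x.
  exact: (below_move_other (fun b => rank s1 b < rank s1 v)).
have s2other h0 x e0 k1 : h0 \in domf (heaps s) `\` [fset h] ->
    holds s2 h0 x e0 k1 <-> holds s h0 x e0 k1.
  rewrite !inE => /andP[/eqP h0h]; rewrite -fndSome.
  case hH0: (heaps s).[? h0] => [H0|] // _.
  rewrite (holdsE (s := s2) _ _ _ hH0) (holdsE _ _ _ hH0) below2_other; first last.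
  - move=> /(in_heapE (s := s) _ hH0) /(in_heap_node fs rs) ; exact/negP.
  - by move=> /(in_heapE (s := s) _ hH0) uh0; apply: h0h; apply: in_heap_inj fs rs uh0 uh.
  split=> -[xH xn]; split=> //; move: xn.
    have xh0 : in_heap s h0 x by apply/(in_heapE _ hH0).
    rewrite s2n //; last exact/neq_v/(in_heap_node fs rs xh0).
    by move=> xu; apply: h0h; apply: in_heap_inj fs rs xh0 _; rewrite xu.
  have xh0 : in_heap s h0 x by apply/(in_heapE _ hH0).
  rewrite s2n //; last exact/neq_v/(in_heap_node fs rs xh0).
  by move=> xu; apply: h0h; apply: in_heap_inj fs rs xh0 _; rewrite xu.
have tr : transforms s [fset h] s' h'
    (fun x e0 k1 => (x = v /\ e0 = e /\ k1 = k) \/ (e0 <> e /\ holds s h x e0 k1)).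
  apply: transforms_returned => // x e0 k1.
  rewrite HE below2 //; last exact/(in_heapE _ hH).
  split.
    case=> [[-> [-> ->]]|[e0e hx]]; first by split; [left | exists (j - 2)].
    have [xh [j0 xn]] := hx; split; first by right; apply/(in_heapE _ hH).
    exists j0; rewrite s2n //; last exact/neq_v/(in_heap_node fs rs xh).
    by move=> E; move: xn; rewrite E un => -[/esym].
  move=> [xH [j0 xn]]; have [xv|/eqP xv] := eqVneq x v.
    by left; move: xn; rewrite xv s2v => -[-> ->].
  case: xH => // /(in_heapE (s := s) _ hH) xh; right.
  have xu : x <> u by move=> E; rewrite E s2u in xn.
  rewrite s2n // in xn; have hx : holds s h x e0 k1 by split=> //; exists j0.
  by split=> // E; rewrite E in hx; have [] := holds_key once un hu hx.
split; last first.
  apply: transforms_replaces tr _ => e0 k1; split.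
    by case=> [[-> ->]|[e0e [x hx]]]; [exists v; left | exists x; right].
  by case=> x [[_ [-> ->]]|[e0e hx]]; [left | right; split=> //; exists x].
have root_neq h0 r : is_root s h0 r -> r <> v by move=> /(rs.1)[rN _]; apply: neq_v.
apply: returned_stable => //.
- move=> r; rewrite HE in_fsetU => /orP[/fset1P->|rH].
    split; first exact: node_fnd s2v.
      by move=> a; rewrite arc2 /arc !(negbTE (vroot _)) !andbF.
    by move=> h0 h0v; case: (root_neq h0 v).
  apply: (@roots_of_heaps_returnable _ _ _ _ _ (Heap (roots H) None)) => // r0 r0H.
  by exists h; [rewrite inE | exists H].
- move=> h0 H0; rewrite inE => /eqP h0h hH0; apply: eq_good_heap (good h0 H0 hH0) => r rH0.
  have h0r : is_root s h0 r by exists H0.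
  apply: s2n; last exact: root_neq h0r.
  by move=> ru; apply: h0h; apply: in_heap_inj fs rs _ uh; rewrite -ru; apply: root_in_heap.
- case: (good _ _ hH) => [[E]|[m mP mF]].
    by move/(in_heapE _ hH): uh; rewrite E => /below_fset0.
  have [mE mH mle] := mP.
  have rootH r : r \in roots H -> r <> v by move=> rH; apply: (root_neq h); exists H.
  have m2P : has_min s2 H m.
    by split=> // r rH; rewrite key_le2 ?mle //; apply: rootH.
  have v2P : has_min s2 (singleton_heap v) v.
    split=> //=; first by rewrite inE.
    by move=> r /fset1P->; rewrite /key_le s2v /=.
  have [m' m'P sm] := melded_has_min v2P m2P mel; right; exists m' => //.
  case: sm => -[-> le_m]; first by rewrite /is_full s2v.
  (* The old minimum node is chosen only if its key is at most [k]; for [m = u] this would mean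
     [k0 <= k]. So the node just made hollow never becomes the minimum node. *)
  have mu : m <> u.
    by move=> E; move: le_m; rewrite E /key_le s2u s2v /= leNgt lt_k.
  by rewrite /is_full s2n //; apply: rootH.
apply: (transforms_once_add (u0 := v) (e0 := e) once tr) => [x e0 k1|h0 x k1 h0h hx].
  by case=> [[-> [-> _]]|[e0e hx]]; [left | right; split=> //; exists h, k1].
have [xu _] := holds_key once un hu hx; rewrite xu in hx.
by case/negP: h0h; rewrite inE; apply/eqP; apply: in_heap_inj fs rs hx.1 hu.1.
Qed.

End KeyDecrease.

(** * Deletion and its loops, preservation along executions, termination and progress *)

Section Deletion.
Context {d : Order.disp_t} {K : orderType d} {I : Type}.
Implicit Types (s : state K I) (H : heap) (u v w r h : nat) (e : I) (k : K).

(** Nothing is claimed about the minimum node of [h], but [h] stays live, so the loops can look up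
    its roots. *)
Definition stable_except h s :=
  [/\ wf s, h \in domf (heaps s)
    & forall h0 H0, h0 <> h -> (heaps s).[? h0] = Some H0 -> good_heap s H0].

Definition same_holds s s' :=
  forall h x e k, holds s' h x e k <-> holds s h x e k.

Lemma same_holds_once s s' : same_holds s s' ->
  item_determines_node s -> item_determines_node s'.
Proof.
by move=> E once h1 h2 u1 u2 e k1 k2 /E hu1 /E hu2; apply: once hu1 hu2.
Qed.

Lemma domf_heaps_set s h H H' : (heaps s).[? h] = Some H ->
  domf (heaps s).[h <- H'] = domf (heaps s).
Proof.
move=> hH; rewrite dom_setf; apply/fsetP => x; rewrite !inE.
by case: eqP => // ->; rewrite -fndSome hH.
Qed.

(** The destroyed node is hollow, so no item goes with it. Its children lose their only parent and
    thus qualify as roots; having had a parent, they were roots of no heap before. *)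
Lemma destroy_spec s h H u : stable_except h s -> (heaps s).[? h] = Some H ->
  u \in roots H -> is_hollow s u ->
  let s' := destroy s h H u in
  [/\ stable_except h s', domf (heaps s') = domf (heaps s) & same_holds s s'].
Proof.
move=> [[fs rs once] hs good] hH uH /andP[uN uhol] s'.
have rootu : is_root s h u by exists H.
have [ord par /rank_invariantP ranks] := fs; have [rP rD] := rs.
have uroot := (rP h u rootu).2.
have arcE a b : arc s' a b = arc s a b && (a != u) by rewrite /arc !inE.
have arc_neq a b : arc s a b -> b <> u by move=> ab bu; move: (uroot a); rewrite -bu ab.
have nE x : x <> u -> (nodes s').[? x] = (nodes s).[? x].
  by move=> /eqP xu; rewrite /= fnd_rem1 xu.
have rankE x : x <> u -> rank s' x = rank s x by move=> xu; rewrite /rank nE.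
have fs' : forest s'.
  split.
  - move=> a b; rewrite arcE => /andP[ab /eqP au].
    by rewrite (@key_le_eq _ _ _ s) ?ord // /node_key nE //; apply: arc_neq ab.
  - by move=> a a' b; rewrite !arcE => /andP[ab _] /andP[ab' _]; apply: par ab ab'.
  apply/rank_invariantP => w n; rewrite /= fnd_rem1; case: eqP => // /eqP wu wn.
  apply: perm_trans (ranks w n wn); apply: perm_children => b.
    by rewrite !mem_children arcE wu andbT.
  by rewrite mem_children => /arc_neq; apply: rankE.
have hE h0 : (heaps s').[? h0] = if h0 == h then
    Some (Heap ((roots H `\ u) `|` children s u) (min_node H)) else (heaps s).[? h0].
  by rewrite /= fnd_set.
have other_root h0 r : h0 <> h -> is_root s h0 r -> r <> u.
  by move=> h0h h0r ru; apply: h0h; apply: rD h0r _; rewrite ru.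
have is_rootE h0 r : is_root s' h0 r ->
    r <> u /\ (is_root s h0 r \/ h0 = h /\ arc s u r).
  case=> H0; rewrite hE; case: eqP => [-> [<-] /=|h0h hH0 rH0].
    rewrite in_fsetU in_fsetD1 mem_children => /orP[/andP[/eqP ru rH]|ur].
      by split=> //; left; exists H.
    by split; [apply: arc_neq ur | right].
  have h0r : is_root s h0 r by exists H0.
  by split; [apply: other_root h0r | left].
have rs' : rooted s'.
  split=> [h0 r|h1 h2 r] /is_rootE[ru].
    case=> [/rP[rN rroot]|[_ ur]]; split.
    - by rewrite -fndSome nE // fndSome.
    - by move=> a; rewrite arcE negb_and rroot.
    - by rewrite -fndSome nE // fndSome; have [] := arc_nodes fs ur.
    - by move=> a; rewrite arcE; apply/negP => /andP[ar /eqP]; apply; apply: par ar ur.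
  move=> h1r /is_rootE[_ h2r].
  case: h1r h2r => [h1r|[-> ur]] [h2r|[-> ur']] //; first exact: rD h1r h2r.
    by move: ((rP _ _ h1r).2 u); rewrite ur'.
  by move: ((rP _ _ h2r).2 u); rewrite ur.
have in_heap_destroy h0 x : in_heap s' h0 x <-> x <> u /\ in_heap s h0 x.
  have [->|/eqP h0h] := eqVneq h0 h.
    have h'H := hE h; rewrite eqxx in h'H.
    rewrite (in_heapE _ h'H) (in_heapE _ hH) below_destroy // => v.
    by rewrite mem_children.
  case hH0: (heaps s).[? h0] => [H0|]; last first.
    have h'H0 : (heaps s').[? h0] = None by rewrite hE; move/eqP/negbTE: h0h => ->.
    by split=> [/in_heap_live|[_ /in_heap_live]] [H0]; rewrite ?hH0 ?h'H0.
  have h'H0 : (heaps s').[? h0] = Some H0 by rewrite hE; move/eqP/negbTE: h0h => ->.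
  have uN0 : ~ below (arcs s) (roots H0) u.
    by move=> /(in_heapE _ hH0) u0; apply: h0h; apply: in_heap_inj fs rs u0 (root_in_heap rootu).
  rewrite (in_heapE _ h'H0) (in_heapE _ hH0) below_destroy_other //.
  by split=> [xH0|[]] //; split=> // xu; rewrite xu in xH0.
have hold : same_holds s s'.
  move=> h0 x e k; split=> -[].
    by move=> /in_heap_destroy[xu xh] [j xn]; split=> //; exists j; rewrite -nE.
  move=> xh [j xn]; have xu : x <> u.
    by move=> xu; case/negP: uhol; apply/is_fullP; exists e, k, j; rewrite -xu.
  by split; [apply/in_heap_destroy | exists j; rewrite nE].
have domE : domf (heaps s') = domf (heaps s) by apply: domf_heaps_set hH.
split=> //; split; rewrite ?domE //; first by split=> //; apply: same_holds_once once.
move=> h0 H0 h0h; rewrite hE; case: eqP => // _ hH0.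
apply: eq_good_heap (good h0 H0 h0h hH0) => r rH0; apply: nE.
by apply: (other_root h0) => //; exists H0.
Qed.

(** The winner is full, so with rank [j] its children have ranks 0 to [j - 1]; the loser, of rank
    [j] too, supplies the one rank missing for [j + 1]. The last conclusion keeps all roots full
    during the linking loop. *)
Lemma ranked_link_spec s h H w nw l : stable_except h s ->
  (heaps s).[? h] = Some H -> w \in roots H -> l \in roots H -> w != l ->
  is_full s w -> rank s w = rank s l -> key_le s w l ->
  (nodes s).[? w] = Some nw ->
  let s' := ranked_link s h H w nw l in
  [/\ stable_except h s', domf (heaps s') = domf (heaps s), same_holds s s'
    & forall r, is_full s' r = is_full s r].
Proof.
move=> [[fs rs once] hs good] hH wH lH wl wF rwl kwl wn s'.
have rootw : is_root s h w by exists H.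
have rootl : is_root s h l by exists H.
have [ord par /rank_invariantP ranks] := fs; have [rP rD] := rs.
have [wN wroot] := rP h w rootw; have [lN lroot] := rP h l rootl.
have [e [k [j wn']]] := is_fullP _ _ wF; rewrite wn in wn'; case: wn' => nwE; subst nw.
have arcE a b : arc s' a b = ((a == w) && (b == l)) || arc s a b.
  by rewrite /arc !inE.
have nE x : x <> w -> (nodes s').[? x] = (nodes s).[? x].
  by move=> /eqP/negbTE xw; rewrite /= fnd_set xw.
have nw : (nodes s').[? w] = Some (Node (Full e) k j.+1) by rewrite /= fnd_set eqxx.
have rankE x : x <> w -> rank s' x = rank s x by move=> xw; rewrite /rank nE.
have keyE x : node_key s' x = node_key s x.
  by rewrite /node_key; have [->|/eqP xw] := eqVneq x w; rewrite ?nw ?wn ?nE.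
have arc_neq a b : arc s' a b -> b <> w.
  rewrite arcE => /orP[/andP[_ /eqP->]|ab bw]; first by move/eqP: wl => /nesym.
  by move: (wroot a); rewrite -bw ab.
have fullE r : is_full s' r = is_full s r.
  by rewrite /is_full; have [->|/eqP rw] := eqVneq r w; rewrite ?nw ?wn ?nE.
have fs' : forest s'.
  split.
  - move=> a b; rewrite arcE (@key_le_eq _ _ _ s) // => /orP[/andP[/eqP-> /eqP->]|] //.
    exact: ord.
  - move=> a a' b; rewrite !arcE.
    case/orP=> [/andP[/eqP-> /eqP->]|ab] /orP[/andP[/eqP-> bl]|ab'] //.
    + by move: (lroot a'); rewrite ab'.
    + by move: (lroot a); rewrite -(eqP bl) ab.
    exact: par ab ab'.
  apply/rank_invariantP => x n; have [->|/eqP xw] := eqVneq x w.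
    rewrite nw => -[<-]; rewrite /expected_ranks -addn1 iotaD add0n perm_sym.
    have perm_w : perm_eq (children s' w) (l :: children s w).
      apply: uniq_perm; rewrite ?cons_uniq ?fset_uniq ?andbT // ?mem_children ?lroot //.
      by move=> b; rewrite inE !mem_children arcE eqxx.
    have rankC : [seq rank s' c | c <- children s w] = [seq rank s c | c <- children s w].
      apply/eq_in_map => b; rewrite mem_children => wb; apply: rankE.
      by apply: (arc_neq w); rewrite arcE wb orbT.
    apply: perm_trans (_ : perm_eq _ (j :: [seq rank s c | c <- children s w])) _.
      rewrite perm_catC /= perm_cons perm_sym; exact: ranks wn.
    rewrite perm_sym -rankC.
    have -> : j = rank s' l.
      rewrite rankE -?rwl; first by rewrite /rank wn.
      by move/eqP: wl => /nesym.
    exact: (perm_map (rank s') perm_w).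
  rewrite nE // => xn; apply: perm_trans (ranks x n xn); apply: perm_children => b.
    by rewrite !mem_children arcE; move/eqP/negbTE: xw => ->.
  by rewrite mem_children => xb; apply: rankE; apply: (arc_neq x); rewrite arcE xb orbT.
have hE h0 : (heaps s').[? h0] =
    if h0 == h then Some (Heap (roots H `\ l) (min_node H)) else (heaps s).[? h0].
  by rewrite /= fnd_set.
have is_rootE h0 r : is_root s' h0 r -> r <> l /\ is_root s h0 r.
  case=> H0; rewrite hE; case: eqP => [-> [<-] /=|h0h hH0 rH0].
    by rewrite in_fsetD1 => /andP[/eqP rl rH]; split=> //; exists H.
  have h0r : is_root s h0 r by exists H0.
  by split=> // rl; apply: h0h; apply: rD h0r _; rewrite rl.
have rs' : rooted s'.
  split=> [h0 r|h1 h2 r] /is_rootE[rl].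
    move=> /rP[rN rroot]; split.
      by rewrite -fndSome; have [->|/eqP rw] := eqVneq r w; rewrite ?nw ?nE ?fndSome.
    by move=> a; rewrite arcE negb_or rroot andbT negb_and orbC; move/eqP: rl => ->.
  by move=> h1r /is_rootE[_]; apply: rD h1r.
have in_heap_link h0 x : in_heap s' h0 x <-> in_heap s h0 x.
  have [->|/eqP h0h] := eqVneq h0 h.
    have h'H := hE h; rewrite eqxx in h'H.
    by rewrite (in_heapE _ h'H) (in_heapE _ hH) below_link.
  case hH0: (heaps s).[? h0] => [H0|]; last first.
    have h'H0 : (heaps s').[? h0] = None by rewrite hE; move/eqP/negbTE: h0h => ->.
    by split=> /in_heap_live [H0]; rewrite ?hH0 ?h'H0.
  have h'H0 : (heaps s').[? h0] = Some H0 by rewrite hE; move/eqP/negbTE: h0h => ->.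
  have wN0 : ~ below (arcs s) (roots H0) w.
    by move=> /(in_heapE _ hH0) w0; apply: h0h; apply: in_heap_inj fs rs w0 (root_in_heap rootw).
  by rewrite (in_heapE _ h'H0) (in_heapE _ hH0) below_link_other.
have hold : same_holds s s'.
  move=> h0 x e0 k0; rewrite /holds in_heap_link.
  have [->|/eqP xw] := eqVneq x w; last by rewrite nE.
  by rewrite nw wn; split=> -[xh [j0 [-> -> _]]]; split=> //; eexists.
have domE : domf (heaps s') = domf (heaps s) by apply: domf_heaps_set hH.
split=> //; split; rewrite ?domE //; first by split=> //; apply: same_holds_once once.
move=> h0 H0 h0h; rewrite hE; case: eqP => // _ hH0.
apply: eq_good_heap (good h0 H0 h0h hH0) => r rH0; apply: nE.
by move=> rw; apply: h0h; apply: (rD _ _ w) rootw; exists H0; rewrite -?rw.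
Qed.

(** Shared by three returns: the deletion of an item outside the minimum node and the two exits of
    the linking loop. The new heap may differ from the old in its minimum node only. *)
Lemma finish_spec s h H H' h' : stable_except h s -> (heaps s).[? h] = Some H ->
  roots H' = roots H -> good_heap s H' -> unused s [fset h] h' ->
  let s' := returned s [fset h] h' H' in
  stable s' /\ transforms s [fset h] s' h' (holds s h).
Proof.
move=> [[fs rs once] hs good] hH HE goodH' h'N s'.
have tr : transforms s [fset h] s' h' (holds s h).
  by apply: transforms_returned => // x e k; rewrite HE (holdsE _ _ _ hH).
split=> //; apply: returned_stable => //.
- apply: roots_of_heaps_returnable => // r; rewrite HE => rH.
  by exists h; [rewrite inE | exists H].
- by move=> h0 H0; rewrite inE => /eqP; apply: good.
by apply: transforms_once_sub once tr _ => x e k hx; exists h, k.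
Qed.

(* An execution of [o], started in [s0], has removed exactly its item from the
   heap [h], though [h] is not yet returned. *)
Definition item_deleted s0 (o : op K I) h s := exists e,
  [/\ o = Delete e h \/ o = DeleteMin h /\
        start s0 (FindMin h) (Returned (ResultItem (Some e)) s0),
      domf (heaps s) = domf (heaps s0),
      forall h0 e0 k0, h0 <> h -> contents s h0 e0 k0 <-> contents s0 h0 e0 k0
    & forall e0 k0, contents s h e0 k0 <-> e0 <> e /\ contents s0 h e0 k0].

Lemma item_deleted_same s0 o h s s' : domf (heaps s') = domf (heaps s) ->
  same_holds s s' -> item_deleted s0 o h s -> item_deleted s0 o h s'.
Proof.
move=> domE hE [e [oE domE0 oth new]].
have cE h0 e0 k0 : contents s' h0 e0 k0 <-> contents s h0 e0 k0.
  by split=> -[x /hE hx]; exists x.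
exists e; split=> //; first by rewrite domE.
  by move=> h0 e0 k0 h0h; rewrite cE oth.
by move=> e0 k0; rewrite cE new.
Qed.

Lemma item_deleted_prescribed s0 o h s s' h' : item_deleted s0 o h s ->
  transforms s [fset h] s' h' (holds s h) -> prescribed s0 o (ResultHeap h') s'.
Proof.
move=> [e [oE domE oth new]] [h'N dom' oth' new'].
have R : replaces s0 [fset h] s' h' (fun e0 k0 => e0 <> e /\ contents s0 h e0 k0).
  split; rewrite -?domE //.
    move=> h0 hN e0 k0; rewrite -oth; last first.
      by move: hN; rewrite !inE => /andP[/eqP].
    by split=> -[x /(oth' h0 hN) hx]; exists x.
  by move=> e0 k0; rewrite -new; split=> -[x /new' hx]; exists x.
by case: oE => [->|[-> st]] //; exists e.
Qed.

(** [HollowByDelete] expects the same child ranks as [Full], so the forest survives; and [u] is the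
    only holder of [e], so emptying it removes exactly this item. *)
Lemma hollow_spec s o h u e k j : stable s -> holds s h u e k ->
  (nodes s).[? u] = Some (Node (Full e) k j) ->
  o = Delete e h \/ o = DeleteMin h /\
    start s (FindMin h) (Returned (ResultItem (Some e)) s) ->
  let s1 := set_node s u (Node HollowByDelete k j) in
  stable_except h s1 /\ item_deleted s o h s1.
Proof.
move=> [[fs rs once] good] hu un oE s1.
have s1n x : x <> u -> (nodes s1).[? x] = (nodes s).[? x].
  by move=> /eqP/negbTE xu; rewrite /= fnd_set xu.
have hold h0 x e0 k0 : holds s1 h0 x e0 k0 <-> e0 <> e /\ holds s h0 x e0 k0.
  have [->|/eqP xu] := eqVneq x u.
    split=> [[_ [j0]]|[e0e [_ [j0]]]]; first by rewrite /= fnd_set eqxx.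
    by rewrite un => -[/esym].
  rewrite holds_set_other //; split=> [hx|[]] //; split=> // E; rewrite E in hx.
  by apply: xu; apply: once hx hu.
split; last first.
  exists e; split=> // [h0 e0 k0 h0h|e0 k0].
    split=> -[x hx]; exists x; first by case/hold: hx.
    apply/hold; split=> // E; apply: h0h; rewrite E in hx.
    have xu := once _ _ _ _ _ _ _ hx hu; rewrite xu in hx.
    exact: in_heap_inj fs rs hx.1 hu.1.
  by split=> [[x /hold[e0e hx]]|[e0e [x hx]]]; [split=> //|]; exists x => //; apply/hold.
split.
- split; last first.
  + move=> h1 h2 u1 u2 e0 k1 k2 /hold[_ hu1] /hold[_ hu2]; exact: once hu1 hu2.
  + exact: set_node_rooted.
  apply: (replace_node_forest fs un) => // a b ab; have [ord _ _] := fs.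
  have keyE x : node_key s1 x = node_key s x.
    by rewrite node_key_set_node; case: eqP => // ->; rewrite /node_key un.
  by rewrite (@key_le_eq _ _ _ s) ?ord.
- exact: holds_live hu.
move=> h0 H0 h0h hH0; apply: eq_good_heap (good h0 H0 hH0) => r rH0.
apply: s1n => ru; apply: h0h; apply: in_heap_inj fs rs _ hu.1.
by rewrite -ru; apply: root_in_heap; exists H0.
Qed.

(** Fullness of all roots in the linking phase makes every pair of equal rank linkable and the final
    minimum node full. *)
Definition config_ok (c : config K I) :=
  match c with
  | Ready s | Returned _ s => stable s
  | Destroying h s => stable_except h s
  | Linking h s => stable_except h s /\ forall r, is_root s h r -> is_full s r
  end.

(** [Ready] is excluded because neither [start] nor [tick] leads there: an execution of [o] ends in
    [Returned]. *)
Definition on_track s0 o (c : config K I) :=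
  match c with
  | Ready _ => False
  | Returned r s => prescribed s0 o r s
  | Destroying h s | Linking h s => item_deleted s0 o h s
  end.

Lemma start_delete_ok s o h u e k c : stable s -> holds s h u e k ->
  o = Delete e h \/ o = DeleteMin h /\
    start s (FindMin h) (Returned (ResultItem (Some e)) s) ->
  start_delete s h u c -> config_ok c /\ on_track s o c.
Proof.
move=> ss hu oE; case=> [H e' k' j h' hH mE un h'N|H e' k' j hH mE un].
  have [_ [j0 un0]] := hu; rewrite un in un0; case: un0 => E1 E2 E3; subst e' k' j0.
  have [se del] := hollow_spec ss hu un oE.
  have goodH : good_heap (set_node s u (Node HollowByDelete k j)) H.
    case: (ss.2 _ _ hH) => [[rE mE']|[m [mE' mH mle] mF]]; [by left | right].
    have mu : m == u = false by apply/eqP => E; apply: mE; rewrite mE' E.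
    exists m; last by rewrite /is_full /= fnd_set mu.
    split=> // r rH; rewrite (@key_le_eq _ _ _ s) ?mle // node_key_set_node;
      by case: eqP => // ->; rewrite /node_key un.
  have [ss' tr] := finish_spec se (H := H) (H' := H) hH erefl goodH h'N.
  by split=> //; apply: item_deleted_prescribed del tr.
have [_ [j0 un0]] := hu; rewrite un in un0; case: un0 => E1 E2 E3; subst e' k' j0.
exact: hollow_spec ss hu un oE.
Qed.

Lemma holds_min s h H m e k j : stable s -> (heaps s).[? h] = Some H ->
  roots H <> fset0 -> min_node H = Some m ->
  (nodes s).[? m] = Some (Node (Full e) k j) -> holds s h m e k.
Proof.
move=> ss hH rH mE mn; case: (ss.2 _ _ hH) => [[]|[m' [m'E m'H _] _]] //.
move: m'E; rewrite mE => -[E]; subst m'.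
by split; [apply: root_in_heap; exists H | exists j].
Qed.

Lemma start_ok s o c : stable s -> legal s o -> start s o c ->
  config_ok c /\ on_track s o c.
Proof.
move=> ss + st; case: st; clear o c.
- by move=> h' h'N _; exact: (make_heap_spec ss h'N).
- move=> h H hH rH _; split=> //=.
  by have [x [<-]] := find_min_spec ss (StartFindMinEmpty hH rH).
- move=> h H m e k j hH rH mE mn _; split=> //=.
  by have [x [<-]] := find_min_spec ss (StartFindMin hH rH mE mn).
- by move=> e k h H u s1 H' h' hH uN -> mel h'N [_ new];
  exact: (insert_spec ss new hH uN mel h'N).
- by move=> h1 h2 H1 H2 H' h' hH1 hH2 mel h'N _; exact: (meld_spec ss hH1 hH2 mel h'N).
- move=> e k h H u k0 j m s1 m' h' hH uH un -> mE sm h'N leg.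
  exact: (decrease_key_root_spec ss leg hH uH un mE sm h'N).
- move=> e k h H u k0 j v s1 s2 H' h' hH uh un vN -> -> mel h'N leg.
  exact: (decrease_key_spec ss leg hH uh un vN mel h'N).
- by move=> e h u k c hu sd _; apply: start_delete_ok hu _ sd; [|left].
move=> h H m c hH rH mE sd _.
have [e [k [j mn]]] : exists e k j, (nodes s).[? m] = Some (Node (Full e) k j).
  by case: sd => [H0 e k j h' _ _ mn _|H0 e k j _ _ mn]; exists e, k, j.
apply: start_delete_ok (holds_min ss hH rH mE mn) _ sd => //.
by right; split=> //; apply: StartFindMin hH rH mE mn.
Qed.

Lemma tick_ok c c' : config_ok c -> tick c c' ->
  config_ok c' /\ forall s0 o, on_track s0 o c -> on_track s0 o c'.
Proof.
move=> + t; case: t; clear c c'.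
- move=> h s H u hH uH uhol ok.
  have [se domE hold] := destroy_spec ok hH uH uhol.
  by split=> // s0 o; apply: item_deleted_same.
- move=> h s H hH full ok; split=> //=; split=> // r hr; have [H0 hH0 rH0] := hr.
  move: hH0; rewrite hH => -[E]; subst H0; have := full r rH0.
  have [_ rs _] : wf s by case: ok.
  by rewrite /is_hollow (rs.1 h r hr).1 negbK.
- move=> h s H w nw l hH wH lH wl wF lF rwl kwl wn [ok full].
  have [se domE hold fullE] := ranked_link_spec ok hH wH lH wl wF rwl kwl wn.
  split; last by move=> s0 o; apply: item_deleted_same.
  split=> // r [H0]; rewrite /= fnd_set eqxx => -[<-] /=.
  by rewrite in_fsetD1 fullE => /andP[_ rH]; apply: full; exists H.
- move=> h s H h' hH rH h'N [ok full].
  have [|ss tr] := finish_spec (H' := empty_heap) ok hH (esym rH) _ h'N; first by left.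
  by split=> // s0 o del; apply: item_deleted_prescribed del tr.
move=> h s H m h' hH inj mH mle h'N [ok full].
have goodH : good_heap s (Heap (roots H) (Some m)).
  by right; exists m; [split | apply: full; exists H].
have [ss tr] := finish_spec (H' := Heap (roots H) (Some m)) ok hH erefl goodH h'N.
by split=> // s0 o del; apply: item_deleted_prescribed del tr.
Qed.

Lemma init_stable : stable (@init_state d K I).
Proof.
have noheap h : (heaps (@init_state d K I)).[? h] = None by rewrite fnd_fmap0.
split; last by move=> h H; rewrite noheap.
split.
- split=> [u v|u u' v|u n]; rewrite /arc ?inE //.
  by rewrite /= fnd_fmap0.
- by split=> [h r|h h' r] [H]; rewrite noheap.
by move=> h h' u u' e k k' [/in_heap_live[H]]; rewrite noheap.
Qed.

Lemma reachable_ok c : reachable c -> config_ok c.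
Proof.
elim=> //; first exact: init_stable.
- by move=> s o {}c _ ss leg st; have [] := start_ok ss leg st.
- by move=> {}c c' _ ok t; have [] := tick_ok ok t.
Qed.

Lemma config_ok_trees c : config_ok c ->
  heap_ordered_trees (state_of c) /\ rank_invariant (state_of c).
Proof.
have W s : wf s -> heap_ordered_trees s /\ rank_invariant s.
  by move=> [fs rs _]; split; [apply: forest_heap_ordered_trees | case: fs].
by case: c => [s []|h s []|h s [] []|r s []] /= /W.
Qed.

(** For decrease-key the form with a new node is exhibited even when [u] is a root, since it applies
    there too. *)
Lemma start_exists s o : stable s -> legal s o -> exists c, start s o c.
Proof.
move=> ss; have [[fs rs once] good] := ss.
have liveP h : live s h -> exists H, (heaps s).[? h] = Some H.
  by rewrite /live -fndSome; case: (heaps s).[? h] => // H; exists H.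
have nonempty h H e k : (heaps s).[? h] = Some H -> contents s h e k -> roots H <> fset0.
  by move=> hH [x /(holdsE _ _ _ hH)[+ _]] rE; rewrite rE => /below_fset0.
have minP h H : (heaps s).[? h] = Some H -> roots H <> fset0 -> exists m e k j,
    min_node H = Some m /\ (nodes s).[? m] = Some (Node (Full e) k j).
  move=> hH rE; case: (good _ _ hH) => [[]|[m [mE _ _] /is_fullP[e [k [j mn]]]]] //.
  by exists m, e, k, j.
have deleteP h u e k : holds s h u e k -> exists c, start_delete s h u c.
  move=> [uh [j un]]; have [H hH] := in_heap_live uh.
  have [mE|/eqP mE] := eqVneq (min_node H) (Some u).
    by eexists; apply: StartDeleteMinimum hH mE un.
  have [h' h'N] := unused_exists s [fset h].
  by eexists; apply: StartDeleteOther hH mE un h'N.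
case: o => [|h|e k h|h|h1 h2|e k h|e h] /=.
- by move=> _; have [h' h'N] := unused_exists s fset0; eexists; apply: StartMakeHeap h'N.
- move=> /liveP[H hH]; have [rE|/eqP rE] := eqVneq (roots H) fset0.
    by eexists; apply: StartFindMinEmpty hH rE.
  have [m [e [k [j [mE mn]]]]] := minP _ _ hH rE.
  by eexists; apply: StartFindMin hH rE mE mn.
- move=> [/liveP[H hH] _]; have [u uN] := fresh_nat (domf (nodes s)).
  pose s1 := set_node s u (Node (Full e) k 0).
  have [H' mel] : exists H', melded s1 (singleton_heap u) H H'.
    apply: melded_exists; apply: good_heap_min.
      by apply: good_singleton; rewrite /is_full /= fnd_set eqxx.
    apply: eq_good_heap (good _ _ hH) => r rH; rewrite /= fnd_set.
    by case: eqP => // ru; case/negP: uN; rewrite -ru; apply: (rs.1 h r _).1; exists H.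
  have [h' h'N] := unused_exists s1 [fset h].
  by eexists; apply: StartInsert hH uN erefl mel h'N.
- move=> [/liveP[H hH] [e [k /(nonempty _ _ _ _ hH) rE]]].
  have [m [e' [k' [j [mE mn]]]]] := minP _ _ hH rE.
  have [c sd] := deleteP _ _ _ _ (holds_min ss hH rE mE mn).
  by exists c; apply: StartDeleteMin hH rE mE sd.
- move=> [/liveP[H1 hH1] [/liveP[H2 hH2] _]].
  have [H' mel] : exists H', melded s H1 H2 H'.
    by apply: melded_exists; apply: good_heap_min; [apply: good hH1 | apply: good hH2].
  have [h' h'N] := unused_exists s [fset h1; h2].
  by eexists; apply: StartMeld hH1 hH2 mel h'N.
- move=> [/liveP[H hH] [k0 [[u [uh [j un]]] _]]].
  have [v vN] := fresh_nat (domf (nodes s)).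
  pose s2 := move_children (set_node (set_node s u (Node HollowByDecreaseKey k0 j))
              v (Node (Full e) k (j - 2))) u v.
  have [H' mel] : exists H', melded s2 (singleton_heap v) H H'.
    apply: melded_exists.
      by apply: good_heap_min; apply: good_singleton; rewrite /is_full /= fnd_set eqxx.
    (* Only [has_min] can be transferred to [s2], not [good_heap]: [m] may be the node [u], now
       hollow. *)
    case: (good_heap_min (good _ _ hH)) => [|[m [mE mH mle]]]; [by left | right].
    exists m; split=> // r rH; rewrite (@key_le_eq _ _ _ s) ?mle //.
      rewrite /node_key /= !fnd_set.
      case: eqP => [E|_]; last by case: eqP => // ->; rewrite un.
      by case/negP: vN; rewrite -E; apply: (rs.1 h m _).1; exists H.
    rewrite /node_key /= !fnd_set.
    case: eqP => [E|_]; last by case: eqP => // ->; rewrite un.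
    by case/negP: vN; rewrite -E; apply: (rs.1 h r _).1; exists H.
  have [h' h'N] := unused_exists s2 [fset h].
  by eexists; apply: StartDecreaseKey hH uh un vN erefl erefl mel h'N.
move=> [_ [k [u hu]]]; have [c sd] := deleteP _ _ _ _ hu.
by exists c; apply: StartDelete hu sd.
Qed.

(** The phases are treated in reverse order of execution, since [Destroying] leads to [Linking] and
    [Linking] to [Returned]. *)
Lemma tick_acc (c : config K I) : Acc (fun c2 c1 => tick c1 c2) c.
Proof.
have ready s : Acc (fun c2 c1 => tick c1 c2) (Ready s) by constructor=> c' t; inversion t.
have ret x s : Acc (fun c2 c1 => tick c1 c2) (Returned x s).
  by constructor=> c' t; inversion t.
have link h s : Acc (fun c2 c1 => tick c1 c2) (Linking h s).
  (* The default 0 stands for a dead handle, from which no tick is possible. *)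
  have [n] := ubnP (oapp (fun H => #|` roots H|) 0 (heaps s).[? h]).
  elim: n s => [s|n IH s sn]; first by rewrite ltn0.
  constructor=> c' t.
  inversion t as [| |h0 s0 H w nw l hH wH lH| |]; subst; try exact: ret.
  apply: IH; rewrite /= fnd_set eqxx /=.
  by move: sn; rewrite hH /= (cardfsD1 l) lH.
have destr h s : Acc (fun c2 c1 => tick c1 c2) (Destroying h s).
  have [n] := ubnP #|` domf (nodes s)|.
  elim: n s => [s|n IH s sn]; first by rewrite ltn0.
  constructor=> c' t.
  inversion t as [h0 s0 H u hH uH uhol| | | |]; subst; try exact: link.
  apply: IH; move: sn; case/andP: uhol => uN _.
  by rewrite (cardfsD1 u) uN -[nodes (destroy _ _ _ _)]/(nodes s).[~ u] domf_rem.
case: c; [exact: ready | exact: destr | exact: link | exact: ret].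
Qed.

Lemma argmin_key s (R : {fset nat}) : {subset R <= domf (nodes s)} ->
  R = fset0 \/ exists2 m, m \in R & forall r, r \in R -> key_le s m r.
Proof.
move=> RN; suff: forall l : seq nat, {subset l <= domf (nodes s)} ->
    l = [::] \/ exists2 m, m \in l & forall r, r \in l -> key_le s m r.
  case/(_ R RN) => [R0|]; last by right.
  by left; apply/fsetP => x; rewrite inE -[x \in R]/(x \in (R : seq nat)) R0.
elim=> [|x l IH] lN; first by left.
have xN : x \in domf (nodes s) by apply: lN; rewrite inE eqxx.
have [|l0|[m ml mle]] := IH; first by move=> y yl; apply: lN; rewrite inE yl orbT.
  right; exists x; first by rewrite inE eqxx.
  by move=> r; rewrite l0 mem_seq1 => /eqP->; case: (key_le_total xN xN).
have mN : m \in domf (nodes s) by apply: lN; rewrite inE ml orbT.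
right; case: (key_le_total xN mN) => [xm|mx].
  exists x; first by rewrite inE eqxx.
  move=> r; rewrite inE => /predU1P[->|/mle]; last exact: key_le_trans xm.
  by case: (key_le_total xN xN).
exists m; first by rewrite inE ml orbT.
by move=> r; rewrite inE => /predU1P[->|/mle].
Qed.

Lemma tick_progress s0 o c : config_ok c -> on_track s0 o c ->
  (exists c', tick c c') \/
  (exists x s', c = Returned x s' /\ prescribed s0 o x s').
Proof.
case: c => [s|h s|h s|r s] //= ok tr; last by right; exists r, s.
  left; have [_ hs _] := ok.
  move: hs; rewrite -fndSome; case hH: (heaps s).[? h] => [H|] // _.
  case: (boolP (has (is_hollow s) (roots H))) => [/hasP[u uH uhol]|/hasPn nohol].
    by eexists; apply: TickDestroy hH uH uhol.
  by eexists; apply: TickDestroyed hH nohol.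
left; have [[[fs rs _] hs _] full] := ok.
move: hs; rewrite -fndSome; case hH: (heaps s).[? h] => [H|] // _.
have [h' h'N] := unused_exists s [fset h].
have rootN : {subset roots H <= domf (nodes s)}.
  by move=> r rH; apply: (rs.1 h r _).1; exists H.
case: (argmin_key rootN) => [rE|[m mH mle]].
  by eexists; apply: TickFinishEmpty hH rE h'N.
(* A boolean form of injectivity of the rank on the roots: its failure produces two distinct roots
   of equal rank, and the order of their keys decides which of them wins. *)
case: (boolP (all (fun w => all (fun l => (rank s w == rank s l) ==> (w == l)) (roots H)) (roots H))).
  move=> /allP inj; eexists; apply: TickFinish hH _ mH mle h'N => w l wH lH /eqP rwl.
  by have /allP/(_ l lH) := inj w wH; rewrite rwl => /eqP.
case/allPn=> w wH /allPn[l lH]; rewrite negb_imply => /andP[/eqP rwl wl].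
have fullH r : r \in roots H -> is_full s r by move=> rH; apply: full; exists H.
case: (key_le_total (rootN _ wH) (rootN _ lH)) => le_wl.
  have [e [k [j wn]]] := is_fullP _ _ (fullH w wH).
  by eexists; apply: TickLink hH wH lH wl (fullH _ wH) (fullH _ lH) rwl le_wl wn.
have [e [k [j ln]]] := is_fullP _ _ (fullH l lH); rewrite eq_sym in wl.
by eexists; apply: TickLink hH lH wH wl (fullH _ lH) (fullH _ wH) (esym rwl) le_wl ln.
Qed.

(** [config_ok] and [on_track] persist along an execution, so progress applies at each of its
    configurations; at [Returned] the latter is the postcondition. *)
Lemma stable_implements s o : stable s -> legal s o -> implements s o.
Proof.
move=> ss leg; split; first exact: start_exists.
move=> c /(start_ok ss leg)[ok tr]; split=> [|c' st]; first exact: tick_acc.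
suff [ok' tr'] : config_ok c' /\ on_track s o c' by apply: tick_progress.
elim: st ok tr => [c1 c2 t ok /((tick_ok ok t).2 s o) tr|//|c1 c2 c3 _ IH1 _ IH2 ok tr].
  by split=> //; apply: (tick_ok ok t).1.
by have [ok' tr'] := IH1 ok tr; apply: IH2.
Qed.

End Deletion.

Theorem theorem2p1 (d : Order.disp_t) (K : orderType d) (I : Type) :
  (forall c : config K I, reachable c ->
     heap_ordered_trees (state_of c) /\ rank_invariant (state_of c)) /\
  (forall s : state K I, reachable (Ready s) ->
     minimum_nodes s /\ items_held_once s /\
     forall o : op K I, legal s o -> implements s o).
Proof.
split=> [c /reachable_ok|s /reachable_ok ss]; first exact: config_ok_trees.
split; first exact: stable_minimum_nodes.
by split=> [|o]; [apply: wf_items_held_once ss.1 | apply: stable_implements].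
Qed.
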